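(* The following two statements hold for any $\epsilon>0$ (and every positive integer $n$, with $Y_1,\dots,Y_n$ i.i.d. from $P_0$ and $\mathbf Y_n=\{Y_i\}_{i=1}^n$). 1. Let the kernel $k$ be such that $\sup_{x\in\mathcal X}k(x,x)\le\kappa<\infty$, and let $D_k$ be the divergence associated with the kernel score $S_k$. Consider $\theta^\star\in\arg\min_{\theta\in\Theta}D_k(P_\theta,P_0)$. If the prior $\pi(\theta)$ satisfies the prior mass condition for $D_k$ with constants $\alpha_1,\alpha_2>0$, then the kernel score posterior $\pi_{S_k}$ satisfies $$P_0\left(\left|\int_\Theta D_k(P_\theta,P_0)\,\pi_{S_k}(\theta|\mathbf Y_n)\,d\theta-D_k(P_{\theta^\star},P_0)\right|\ge\epsilon\right)\le2\exp\left\{-\frac12\left(\frac{\sqrt n\,\epsilon-\alpha_1-\alpha_2/w}{8\kappa}\right)^2\right\}.$$ 2. Assume the space $\mathcal X$ is bounded such that $\sup_{x,y\in\mathcal X}\|x-y\|_2\le B<\infty$, and let $D_{\mathrm E}^{(\beta)}$ be the divergence associated with the energy score $S_{\mathrm E}^{(\beta)}$. Consider $\theta^\star\in\arg\min_{\theta\in\Theta}D_{\mathrm E}^{(\beta)}(P_\theta,P_0)$. If the prior $\pi(\theta)$ satisfies the prior mass condition for $D_{\mathrm E}^{(\beta)}$ with constants $\alpha_1,\alpha_2>0$, then the energy score posterior $\pi_{S_{\mathrm E}^{(\beta)}}$ satisfies $$P_0\left(\left|\int_\Theta D_{\mathrm E}^{(\beta)}(P_\theta,P_0)\,\pi_{S_{\mathrm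 E}^{(\beta)}}(\theta|\mathbf Y_n)\,d\theta-D_{\mathrm E}^{(\beta)}(P_{\theta^\star},P_0)\right|\ge\epsilon\right)\le2\exp\left\{-\frac12\left(\frac{\sqrt n\,\epsilon-\alpha_1-\alpha_2/w}{8B^\beta}\right)^2\right\}.$$
   Context: $\mathcal X\subseteq\mathbb R^d$ (data space) and $\Theta\subseteq\mathbb R^p$ (parameter space) are Borel sets; $\{P_\theta\}_{\theta\in\Theta}$ is a family of probability distributions on $\mathcal X$; $P_0$ is the data-generating distribution, and $P_0(\cdot)$ of an event denotes probability over the i.i.d. sample $\mathbf Y_n$. The model need not contain $P_0$ and the minimizer $\theta^\star$ need not be unique. Scoring rules: for $k:\mathcal X\times\mathcal X\to\mathbb R$ a symmetric positive-definite kernel, the kernel score is $S_k(P,y)=\mathbb E[k(X,X')]-2\,\mathbb E[k(X,y)]$ with $X,X'\sim P$ independent. For $\beta\in(0,2)$, the energy score is $S_{\mathrm E}^{(\beta)}(P,y)=2\,\mathbb E\|X-y\|_2^\beta-\mathbb E\|X-X'\|_2^\beta$ with $X,X'\sim P$ independent. Divergence associated with a scoring rule $S$: $D(P,Q)=S(P,Q)-S(Q,Q)$, where $S(P,Q)=\mathbb E_{Y\sim Q}S(P,Y)$. Explicitly, with $X,X'\sim P$ and $Y,Y'\sim Q$ all independent, $D_k(P,Q)=\mathbb E k(X,X')+\mathbb E k(Y,Y')-2\,\mathbb E k(X,Y)$ and $D_{\mathrm E}^{(\beta)}(P,Q)=2\,\mathbb E\|X-Y\|_2^\beta-\mathbb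 E\|X-X'\|_2^\beta-\mathbb E\|Y-Y'\|_2^\beta$. Scoring rule posterior: for learning rate $w>0$ and prior density $\pi$, $\pi_S(\theta|\mathbf Y_n)\propto\pi(\theta)\exp\{-w\sum_{i=1}^nS(P_\theta,Y_i)\}$, a probability density on $\Theta$. The kernel and energy score posteriors are obtained with $S=S_k$ and $S=S_{\mathrm E}^{(\beta)}$. Prior mass condition for a divergence $D$, with constants $\alpha_1,\alpha_2>0$: the prior has a density $\pi(\theta)$ with respect to Lebesgue measure satisfying $\int_{B_n(\alpha_1)}\pi(\theta)\,d\theta\ge e^{-\alpha_2\sqrt n}$ for all positive $n\in\mathbb N$, where $B_n(\alpha_1):=\{\theta\in\Theta:|D(P_\theta,P_0)-D(P_{\theta^\star},P_0)|\le\alpha_1/\sqrt n\}$ and $\theta^\star\in\arg\min_{\theta\in\Theta}D(P_\theta,P_0)$, the latter set being assumed nonempty.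
   Formalization: Both bounds are stated only for ε with √n·ε ≥ α1 + α2/w; for smaller ε the literal inequality can fail, because the square in the exponent ignores the sign of √n·ε − α1 − α2/w. *)

(* Defs.v *)
(* R^d is [d.-tuple R]; its canonical sigma-algebra, generated by the
   coordinate projections, is the Borel sigma-algebra. *)
From HB Require Import structures.
From mathcomp Require Import all_boot all_order all_algebra.
From mathcomp Require Import all_classical all_reals all_analysis.
From mathcomp Require Import measurable_realfun.

Set Implicit Arguments.
Unset Strict Implicit.
Unset Printing Implicit Defensive.
Import Order.TTheory GRing.Theory Num.Theory.
Import numFieldNormedType.Exports.
Local Open Scope classical_set_scope.
Local Open Scope ring_scope.

Section cons_measure.
Context {dT : measure_display} {T : measurableType dT} {R : realType}.
Variables (m : {sigma_finite_measure set T -> \bar R}) (n : nat).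
Variable mu : {sigma_finite_measure set (n.-tuple T) -> \bar R}.
Local Open Scope ereal_scope.

Definition tuple_of_pair (x : T * n.-tuple T) : n.+1.-tuple T :=
  [tuple of x.1 :: x.2].

Definition pair_of_tuple (t : n.+1.-tuple T) : T * n.-tuple T :=
  (thead t, [tuple of behead t]).

Lemma tuple_of_pairK : cancel tuple_of_pair pair_of_tuple.
Proof. by move=> [x t]; congr pair; apply/val_inj. Qed.

Lemma measurable_tuple_of_pair : measurable_fun setT tuple_of_pair.
Proof. exact: measurable_cons. Qed.

Lemma measurable_pair_of_tuple : measurable_fun setT pair_of_tuple.
Proof.
apply: measurable_fun_pair; last exact: measurable_behead.
exact: (measurable_tnth ord0).
Qed.

Definition cons_measure : set (n.+1.-tuple T) -> \bar R :=
  pushforward (m \x mu) tuple_of_pair.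

Let nu : {measure set _ -> \bar R} :=
  measure_function_pushforward__canonical__measure_function_Measure
    (m \x mu) measurable_tuple_of_pair.

HB.instance Definition _ := isMeasure.Build _ _ _ cons_measure
  (measure0 nu) (measure_ge0 nu) (@measure_semi_sigma_additive _ _ _ nu).

Let cons_measure_sigma_finite : sigma_finite setT cons_measure.
Proof.
have /sigma_finiteP[F [TF ndF Foo]] := sigma_finiteT m.
have /sigma_finiteP[G [TG ndG Goo]] := sigma_finiteT mu.
exists (fun i => pair_of_tuple @^-1` (F i `*` G i)).
  rewrite -preimage_bigcup (_ : \bigcup_i _ = setT) ?preimage_setT//.
  rewrite -subTset => -[x y] _.
  have [i _ Fix] : (\bigcup_i F i) x by rewrite -TF.
  have [j _ Gjy] : (\bigcup_i G i) y by rewrite -TG.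
  exists (maxn i j) => //; split.
    by move: x Fix; exact/subsetPset/ndF/leq_maxl.
  by move: y Gjy; exact/subsetPset/ndG/leq_maxr.
move=> i; have [mFi Fi] := Foo i; have [mGi Gi] := Goo i; split.
  rewrite -[X in measurable X]setTI; apply: measurable_pair_of_tuple => //.
  exact: measurableX.
rewrite /cons_measure /pushforward (_ : _ @^-1` _ = F i `*` G i); last first.
  by rewrite -comp_preimage (_ : _ \o _ = id)//; exact/funext/tuple_of_pairK.
by rewrite product_measure1E// lte_mul_pinfty// ge0_fin_numE.
Qed.

HB.instance Definition _ := Measure_isSigmaFinite.Build _ _ _ cons_measure
  cons_measure_sigma_finite.

End cons_measure.

(* n-fold product measure m \x ... \x m *)
Fixpoint tuple_measure {dT : measure_display} {T : measurableType dT}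
    {R : realType} (m : {sigma_finite_measure set T -> \bar R}) (n : nat) :
    {sigma_finite_measure set (n.-tuple T) -> \bar R} :=
  match n with
  | 0 => \d_([tuple] : 0.-tuple T)
  | n'.+1 => cons_measure m (tuple_measure m n')
  end.

Lemma tuple_measure_box (dT : measure_display) (T : measurableType dT)
    (R : realType) (m : {sigma_finite_measure set T -> \bar R}) (n : nat)
    (A : 'I_n -> set T) : (forall i, measurable (A i)) ->
  tuple_measure m n [set t | forall i, A i (tnth t i)] =
  (\prod_(i < n) m (A i))%E.
Proof.
elim: n A => [|n IH] A mA.
  rewrite big_ord0 /= diracE mem_set//.
  by move=> [].
have -> : tuple_measure m n.+1 [set t | forall i, A i (tnth t i)] =
  (m \x tuple_measure m n)%E
   (A ord0 `*` [set t | forall i, A (lift ord0 i) (tnth t i)]).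
  congr (product_measure1 _ _ _); apply/seteqP; split => -[x t] /=.
    move=> h; split; first exact: (h ord0).
    by move=> i; have := h (lift ord0 i); rewrite tnthS.
  move=> [h0 h] i; case: (unliftP ord0 i) => [j ->|->].
    by rewrite tnthS; exact: h.
  exact: h0.
rewrite product_measure1E//; first by rewrite big_ord_recl -IH.
rewrite (_ : [set _ | _] =
  \bigcap_(i in [set: 'I_n]) ((@tnth _ _ ^~ i) @^-1` A (lift ord0 i))).
  apply: fin_bigcap_measurable => // i _.
  by rewrite -[X in measurable X]setTI; exact: measurable_tnth.
by apply/seteqP; split => t /= h i => [_|]; exact: h.
Qed.

Section lebesgue_tuple.
Context {R : realType}.

(* [lebesgue_measure] transported from [measurableTypeR R] to [R]: same
   sigma-algebra, but the two structures have different displays *)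
Definition lebesgueR : set R -> \bar R := @lebesgue_measure R.

HB.instance Definition _ := isMeasure.Build _ _ _ lebesgueR
  (measure0 (@lebesgue_measure R)) (measure_ge0 (@lebesgue_measure R))
  (@measure_semi_sigma_additive _ _ _ (@lebesgue_measure R)).

HB.instance Definition _ := Measure_isSigmaFinite.Build _ _ _ lebesgueR
  (@sigma_finiteT _ _ _ (@lebesgue_measure R)).

Definition lebesgue_tuple (p : nat) :
    {sigma_finite_measure set (p.-tuple R) -> \bar R} :=
  tuple_measure lebesgueR p.

End lebesgue_tuple.

Section scoring_rules.
Context {R : realType} {d : nat}.
Local Notation E := (d.-tuple R).
Local Notation scoring_rule := (probability E R -> E -> R).
Variable X : set E.
Implicit Types (P Q : probability E R) (S : scoring_rule).

Definition norm2 (x : E) : R := Num.sqrt (\sum_(i < d) tnth x i ^+ 2).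

Definition dist2 (x y : E) : R :=
  norm2 [tuple tnth x i - tnth y i | i < d].

(* [k] is a function on X x X: its values elsewhere are irrelevant, in this
   definition and in the integrals below.  "Positive definite" has the usual
   meaning for kernels (Gram matrices are positive semidefinite). *)
Definition pd_kernel (k : E -> E -> R) : Prop :=
  [/\ measurable_fun (X `*` X) (fun z : E * E => k z.1 z.2),
      forall x y, X x -> X y -> k x y = k y x &
      forall (m : nat) (c : 'I_m -> R) (x : 'I_m -> E),
        (forall i, X (x i)) ->
        0 <= \sum_(i < m) \sum_(j < m) c i * c j * k (x i) (x j)].

Definition kernel_score (k : E -> E -> R) : scoring_rule := fun P y =>
  \int[(P \x P)%E]_(z in X `*` X) k z.1 z.2 - 2 * \int[P]_(x in X) k x y.

Definition energy_score (beta : R) : scoring_rule := fun P y =>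
  2 * \int[P]_(x in X) (dist2 x y `^ beta)
  - \int[(P \x P)%E]_(z in X `*` X) (dist2 z.1 z.2 `^ beta).

Definition expected_score S P Q : R := \int[Q]_(y in X) S P y.

Definition divergence S P Q : R := expected_score S P Q - expected_score S Q Q.

End scoring_rules.

Section generalized_posterior.
Context {R : realType} {d p : nat}.
Local Notation E := (d.-tuple R).
Variables (Theta : set (p.-tuple R)) (P : p.-tuple R -> probability E R).

(* A family of distributions on X indexed by Theta, i.e. a Markov kernel from
   Theta to X; measurability in theta is what gives a meaning to the integrals
   over Theta. *)
Definition statistical_model (X : set E) : Prop :=
  (forall theta, Theta theta -> P theta X = 1%E) /\
  (forall A, measurable A -> measurable_fun Theta (fun theta => P theta A)).

Definition is_argmin (D : probability E R -> probability E R -> R)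
    (P0 : probability E R) (thetastar : p.-tuple R) : Prop :=
  Theta thetastar /\
  forall theta, Theta theta -> D (P thetastar) P0 <= D (P theta) P0.

Definition prob_density (prior : p.-tuple R -> R) : Prop :=
  [/\ measurable_fun Theta prior,
      forall theta, Theta theta -> 0 <= prior theta &
      (\int[lebesgue_tuple p]_(theta in Theta) (prior theta)%:E = 1)%E].

Definition near_optimal
    (D : probability E R -> probability E R -> R) (P0 : probability E R)
    (thetastar : p.-tuple R) (a1 : R) (n : nat) : set (p.-tuple R) :=
  [set theta | Theta theta /\
     `|D (P theta) P0 - D (P thetastar) P0| <= a1 / Num.sqrt n%:R].

Definition prior_mass_condition
    (D : probability E R -> probability E R -> R) (P0 : probability E R)
    (thetastar : p.-tuple R) (prior : p.-tuple R -> R) (a1 a2 : R) : Prop :=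
  forall n : nat, (0 < n)%N ->
    ((expR (- (a2 * Num.sqrt n%:R)))%:E <=
     \int[lebesgue_tuple p]_(theta in near_optimal D P0 thetastar a1 n)
       (prior theta)%:E)%E.

Definition score_likelihood (S : probability E R -> E -> R) (w : R) (n : nat)
    (Y : n.-tuple E) (theta : p.-tuple R) : R :=
  expR (- (w * \sum_(i < n) S (P theta) (tnth Y i))).

(* density, with respect to Lebesgue measure on Theta, of the scoring rule
   posterior given the sample Y *)
Definition score_posterior (S : probability E R -> E -> R) (w : R)
    (prior : p.-tuple R -> R) (n : nat) (Y : n.-tuple E)
    (theta : p.-tuple R) : R :=
  prior theta * score_likelihood S w Y theta /
  \int[lebesgue_tuple p]_(t in Theta) (prior t * score_likelihood S w Y t).

(* Samples Y in X^n for which the posterior expectation of D(P_theta, P0)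
   deviates by at least eps from its minimum D(P_thetastar, P0). *)
Definition deviation_event (X : set E) (S : probability E R -> E -> R) (w : R)
    (prior : p.-tuple R -> R) (P0 : probability E R) (thetastar : p.-tuple R)
    (n : nat) (eps : R) : set (n.-tuple E) :=
  [set Y | (forall i, X (tnth Y i)) /\
     eps <= `| \int[lebesgue_tuple p]_(theta in Theta)
                 (divergence X S (P theta) P0
                  * score_posterior S w prior Y theta)
               - divergence X S (P thetastar) P0 |].

End generalized_posterior.

(* Main.v *)
(* Let ||.|| be the seminorm of the centered kernel
   k0(x,y) = k(x,y) - m(x) - m(y) + E m(Y), m(x) = E k(x,Y), Y ~ P0, so that
   ||sum_i (delta_(Y_i) - P0)||^2 = sum_(i,j) k0(Y_i,Y_j) =: q.  By
   Cauchy-Schwarz the empirical risk of every theta differs from its mean by at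
   most 2 b sqrt(q) / n, where b^2 bounds k(x,x) or k0(x,x), up to a shift that
   does not depend on theta and hence does not affect the posterior.  A Gibbs-type
   inequality for the posterior and the prior mass condition then give
   sqrt(n) * excess <= a1 + a2/w + 4 b sqrt(q/n), and sqrt(q) has Pinelis'
   sub-Gaussian tail 2 exp(- r^2 / (2 n c^2)), where k0(x,x) <= c^2.  The kernel
   score has b^2 = kappa and c^2 = 4 kappa.  The energy score is the kernel score
   of k(x,y) = - |x - y|^beta, which is only conditionally positive definite
   (Schoenberg), with b^2 = c^2 = 2 B^beta; in both cases 4 b c is the
   denominator of the stated bound. *)
From HB Require Import structures.
Require Import Defs.
From mathcomp Require Import all_boot all_order all_algebra.
From mathcomp Require Import all_classical all_reals all_analysis.
From mathcomp Require Import measurable_realfun.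
From mathcomp Require Import ring lra.

Set Implicit Arguments.
Unset Strict Implicit.
Unset Printing Implicit Defensive.
Import Order.TTheory GRing.Theory Num.Theory.
Import numFieldNormedType.Exports.
Local Open Scope classical_set_scope.
Local Open Scope ring_scope.

(** * The hyperbolic cosine *)

(** No feature space is built: norms are quadratic forms of finitely supported signed measures, and
    [P0] enters them as a limit of empirical measures. Pinelis' argument then needs only the Gram
    expansion of the squared norm of a sum. It uses [cosh] of the norm because [cosh] is an even
    power series, hence a convex function of the squared norm, with no trouble where the norm
    vanishes. The deviation of the empirical risk is linear in [P theta]: a bound at every point [x]
    passes to all mixtures, so no complexity of the model enters. The obstacle is the energy kernel,
    which defines a seminorm only on measures of mass 0. There Cauchy-Schwarz must be applied to the
    centered kernel, at the price of a shift common to all parameters. A positive definite kernel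
    allows an uncentered atom at [x], of norm at most [sqrt kappa] instead of [2 sqrt kappa]; this
    saves a factor 2. For the energy score the saving comes from the sign of the kernel instead. *)

Section cosh.
Context {R : realType}.
Implicit Types a c t x y z : R.

Definition cosh x : R := (expR x + expR (- x)) / 2.

(** The odd terms of the two exponential series cancel, so these sums are averages of exponential
    partial sums along the even indices. *)
Lemma cosh_series x :
  (fun n => \sum_(0 <= k < n) x ^+ 2 ^+ k / (k.*2)`!%:R) @ \oo --> cosh x.
Proof.
have cvgE (u : R) : series (exp_coeff u) @ \oo --> expR u.
  exact: is_cvg_series_exp_coeff.
have -> : (fun n => \sum_(0 <= k < n) x ^+ 2 ^+ k / (k.*2)`!%:R) =
   (fun n => (series (exp_coeff x) n.*2 + series (exp_coeff (- x)) n.*2) / 2).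
  apply/funext; elim => [|n IH]; first by rewrite /series/= !big_geq// addr0 mul0r.
  rewrite big_nat_recr//= IH doubleS /series/= !big_nat_recr//= /exp_coeff/=.
  have e : (- x) ^+ n.*2 = x ^+ n.*2 by rewrite -mul2n !exprM sqrrN.
  rewrite -exprM mul2n !(exprS _ n.*2) e; set u := n.*2`!%:R; set v := _`!%:R.
  by field; rewrite !pnatr_eq0 -!lt0n !fact_gt0.
have dbl : n.*2 @[n --> \oo] --> \oo.
  apply/cvgnyPge => A; near=> n; rewrite -addnn; apply: (leq_trans _ (leq_addr _ _)).
  by near: n; exact: nbhs_infty_ge.
by apply: cvgM; [apply: cvgD; apply: cvg_comp dbl (cvgE _)|exact: cvg_cst].
Unshelve. all: by end_near. Qed.

Lemma convex_expr t x y k : 0 <= t <= 1 -> 0 <= x -> 0 <= y ->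
  (t * x + (1 - t) * y) ^+ k <= t * x ^+ k + (1 - t) * y ^+ k.
Proof.
move=> /andP[t0 t1] x0 y0; elim: k => [|k IH]; first by rewrite !expr0; lra.
have t1' : 0 <= 1 - t by rewrite subr_ge0.
rewrite exprS; apply: le_trans (_ : (t * x + (1 - t) * y) *
   (t * x ^+ k + (1 - t) * y ^+ k) <= _).
  by rewrite ler_wpM2l// addr_ge0// mulr_ge0.
(* The defect left by the induction hypothesis has this form; it is nonnegative because [x] and [y]
   are ordered like their powers. *)
rewrite -subr_ge0 !exprS [X in 0 <= X](_ : _ =
   t * (1 - t) * ((x - y) * (x ^+ k - y ^+ k))); last by ring.
apply: mulr_ge0; first exact: mulr_ge0.
have [xy|/ltW xy] := leP x y.
  by rewrite mulr_le0// subr_le0// lerXn2r// nnegrE.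
by rewrite mulr_ge0// subr_ge0// lerXn2r// nnegrE.
Qed.

(* [cosh] is a convex nondecreasing function of the square of its argument,
   because the coefficients of its power series are nonnegative. *)
Lemma cosh_convex_sqr t x y z : 0 <= t <= 1 ->
  z ^+ 2 <= t * x ^+ 2 + (1 - t) * y ^+ 2 ->
  cosh z <= t * cosh x + (1 - t) * cosh y.
Proof.
move=> t01 zxy; have /andP[t0 t1] := t01.
have cxy : (fun n => t * \sum_(0 <= k < n) x ^+ 2 ^+ k / (k.*2)`!%:R +
   (1 - t) * \sum_(0 <= k < n) y ^+ 2 ^+ k / (k.*2)`!%:R) @ \oo -->
   t * cosh x + (1 - t) * cosh y.
  by apply: cvgD; apply: cvgM; (exact: cvg_cst) || exact: cosh_series.
refine (ler_cvg_to (@cosh_series z) cxy _).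
near=> n; rewrite !mulr_sumr -big_split/= ler_sum// => k _.
rewrite !mulrA -mulrDl ler_wpM2r// ?invr_ge0//.
apply: le_trans (convex_expr _ t01 (sqr_ge0 _) (sqr_ge0 _)).
by rewrite lerXn2r// ?nnegrE ?sqr_ge0// addr_ge0// mulr_ge0// ?sqr_ge0// subr_ge0.
Unshelve. all: by end_near. Qed.

(* The bound is affine in [z], so averaging over a centered [z] leaves
   [cosh a * cosh c]. *)
Lemma cosh_two_point a c : 0 <= a -> 0 <= c ->
  (* At [z = - a c] and [z = a c] the bound on [v ^+ 2] is [(a - c) ^+ 2] and [(a + c) ^+ 2]; [D] is
     the slope of the chord between them. If [a * c = 0] then [z = 0], and division by zero makes
     [D] vanish. *)
  exists D : R, forall z v : R, `|z| <= a * c -> v ^+ 2 <= a ^+ 2 + c ^+ 2 + 2 * z ->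
    cosh v <= cosh a * cosh c + D * z.
Proof.
move=> a0 c0; exists ((cosh (a + c) - cosh (a - c)) / 2 / (a * c)) => z v zac hv.
pose t := (1 + z / (a * c)) / 2.
have coshac : cosh a * cosh c = (cosh (a + c) + cosh (a - c)) / 2.
  by rewrite /cosh !opprD opprK !expRD; field.
have zE : z = z / (a * c) * (a * c).
  have [ac0|ac0] := eqVneq (a * c) 0.
    by apply/eqP; rewrite ac0 mulr0 -normr_le0 -ac0.
  by rewrite divfK.
have t01 : 0 <= t <= 1.
  have : `|z / (a * c)| <= 1.
    have [ac0|ac0] := eqVneq (a * c) 0.
      by rewrite ac0 invr0 mulr0 normr0.
    rewrite normrM normfV (ger0_norm (mulr_ge0 a0 c0)) ler_pdivrMr ?mul1r//.
    by rewrite lt_neqAle eq_sym ac0 mulr_ge0.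
  by rewrite ler_norml /t => /andP[h1 h2]; apply/andP; split; lra.
have hv' : v ^+ 2 <= t * (a + c) ^+ 2 + (1 - t) * (a - c) ^+ 2.
  apply: le_trans hv _; rewrite {1}zE /t -subr_ge0.
  by rewrite [X in 0 <= X](_ : _ = 0)//; set u := z / _; field.
refine (le_trans (@cosh_convex_sqr t (a + c) (a - c) v t01 hv') _).
rewrite coshac /t [_ / (a * c) * z]mulrAC -[_ * z / (a * c)]mulrA -subr_ge0.
by rewrite [X in 0 <= X](_ : _ = 0)//; set u := z / (a * c); field.
Qed.

Lemma double_fact_ge k : (2 ^ k * k`! <= (k.*2)`!)%N.
Proof.
elim: k => // k IH; rewrite doubleS !factS expnS.
have -> : (2 * 2 ^ k * (k.+1 * k`!) = (k.+1.*2) * (2 ^ k * k`!))%N.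
  by rewrite -muln2; ring.
by rewrite doubleS leq_mul2l/= (leq_trans IH)// leq_pmull.
Qed.

(** Termwise comparison of the two power series: [double_fact_ge] compares the denominators [(2k)!]
    and [2^k k!]. *)
Lemma cosh_le_expR x : cosh x <= expR (x ^+ 2 / 2).
Proof.
have cvgE (u : R) : series (exp_coeff u) @ \oo --> expR u.
  exact: is_cvg_series_exp_coeff.
refine (ler_cvg_to (@cosh_series x) (@cvgE _) _).
near=> n; rewrite /series/= ler_sum// => k _; rewrite /exp_coeff/=.
rewrite expr_div_n -[leRHS]mulrA ler_wpM2l ?(exprn_ge0 _ (sqr_ge0 _))//.
rewrite -[leRHS]invfM lef_pV2 ?posrE ?mulr_gt0 ?exprn_gt0 ?ltr0n ?fact_gt0//.
by rewrite -natrX -natrM ler_nat double_fact_ge.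
Unshelve. all: by end_near. Qed.

(** This half is the origin of the factor 2 in front of the final bound. *)
Lemma cosh_ge x : expR x / 2 <= cosh x.
Proof. by rewrite /cosh ler_wpM2r ?invr_ge0// lerDl expR_ge0. Qed.

Lemma cosh_gt0 x : 0 < cosh x.
Proof. by apply: lt_le_trans (cosh_ge x); rewrite divr_gt0 ?expR_gt0. Qed.

Lemma measurable_cosh : measurable_fun [set: R] cosh.
Proof.
rewrite (_ : cosh = (expR \+ (expR \o -%R)) \* cst 2^-1)//.
apply: measurable_funM; last exact: measurable_cst.
apply: measurable_funD; first exact: measurable_expR.
by apply: measurableT_comp; [exact: measurable_expR|exact: oppr_measurable].
Qed.

End cosh.

(** * The binomial series of (1 - x)^a *)

Section binomial_series.
Context {R : realType}.
Variable a : R.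
Hypothesis a01 : 0 < a <= 1.

(* 1 - (1 - x)^a = sum_k bin_coeff k x^(k+1) *)
Fixpoint bin_coeff (k : nat) : R :=
  if k is k'.+1 then bin_coeff k' * ((k'.+1%:R - a) / k'.+2%:R) else a.

(** This is where [a <= 1] matters: signs that were not constant would spoil the nonnegative
    combination of Gaussians in [cpsd_expR]. *)
Lemma bin_coeff_ge0 k : 0 <= bin_coeff k.
Proof.
have /andP[a0 a1] := a01.
elim: k => [|k IH] /=; first exact: ltW.
rewrite mulr_ge0// divr_ge0// subr_ge0 (le_trans a1)// ler1n//.
Qed.

(** The left-hand side is nonincreasing in [k], with successive ratios [(k.+1 - a) / k.+1]. The
    bound makes the coefficient of the remainder in [bin_sum_ode] uniform in [n]. *)
Lemma bin_coeff_le k : k.+1%:R * bin_coeff k <= a.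
Proof.
have /andP[a0 a1] := a01.
elim: k => [|k IH] /=; first by rewrite mul1r.
apply: le_trans IH; rewrite mulrCA (mulrC k.+2%:R) divfK ?pnatr_eq0//.
rewrite (mulrC k.+1%:R) ler_wpM2l ?bin_coeff_ge0//; lra.
Qed.

Definition bin_sum n : {poly R} := \sum_(k < n) (bin_coeff k)%:P * 'X^(k.+1).

(** The function [1 - (1 - x)^a] solves [(1 - x) S' = a (1 - S)] with [S(0) = 0]; the partial sums
    solve it up to a single monomial. *)
Lemma bin_sum_ode n :
  (1 - 'X) * (bin_sum n.+1)^`() =
  a%:P * (1 - bin_sum n.+1) - ((n.+1%:R - a) * bin_coeff n)%:P * 'X^(n.+1).
Proof.
elim: n => [|n IH].
  rewrite /bin_sum big_ord_recl big_ord0 addr0 expr1 derivM derivC mul0r add0r.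
  by rewrite derivX mulr1 /= mulrBl mul1r !polyCM polyCB; ring.
have -> : bin_sum n.+2 = bin_sum n.+1 + (bin_coeff n.+1)%:P * 'X^(n.+2).
  by rewrite /bin_sum big_ord_recr.
have e : (n.+1%:R - a) * bin_coeff n = n.+2%:R * bin_coeff n.+1.
  by rewrite /= mulrCA (mulrC n.+2%:R) divfK ?pnatr_eq0// mulrC.
move: IH; rewrite e; move: (bin_coeff n.+1) (bin_sum n.+1) => b S IH.
rewrite derivD mulrDr IH derivM derivC mul0r add0r derivXn.
rewrite [n.+2.-1]/= -mulr_natr !polyCM polyCB !polyC_natr (exprS _ n.+1); ring.
Qed.

Lemma cvg_bin_sum x : 0 <= x < 1 ->
  (bin_sum n.+1).[x] @[n --> \oo] --> 1 - (1 - x) `^ a.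
Proof.
move=> /andP[x0 x1]; have /andP[a0 a1] := a01.
(* Integrating factor: [h n] would be constantly 1 if the differential equation held exactly. Its
   derivative [dh n] is the remainder of [bin_sum_ode], so the mean value theorem bounds [h n x - 1]
   by a geometric term. *)
pose h n (y : R) := (1 - (bin_sum n.+1).[y]) * (1 - y) `^ (- a).
pose dh n (y : R) := (n.+1%:R - a) * bin_coeff n * y ^+ n.+1 * (1 - y) `^ (- a - 1).
have dhE n (y : R) : y < 1 -> is_derive y 1 (h n) (dh n y).
  move=> y1; have y1' : 0 < 1 - y by rewrite subr_gt0.
  have d1 : is_derive y 1 (fun y : R => 1 - y) (-1).
    by rewrite -[X in is_derive _ _ _ X]add0r; apply: is_deriveB.
  have d2 : is_derive y 1 (fun y : R => (1 - y) `^ (- a))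
     (a * (1 - y) `^ (- a - 1)).
    have := @is_derive1_comp _ (fun u => u `^ (- a)) (fun y => 1 - y) y _ _
      (is_derive1_powR (- a) y1') d1.
    by rewrite mulrN1 mulNr opprK.
  have d3 : is_derive y 1 (fun y : R => 1 - (bin_sum n.+1).[y])
     (- ((bin_sum n.+1)^`()).[y]).
    by rewrite -[X in is_derive _ _ _ X]add0r; apply: is_deriveB.
  have := is_deriveM d3 d2.
  move=> H; apply: (is_derive_eq H); rewrite /dh.
  rewrite -[_ *: _ in LHS]/(_ * _) -[X in _ + X]/(_ * _).
  have := congr1 (fun p => p.[y]) (bin_sum_ode n); rewrite !hornerE/= => ode.
  have -> : (1 - y) `^ (- a) = (1 - y) `^ (- a - 1) * (1 - y).
    rewrite -{1}(subrK 1 (- a)) powRD ?powRr1 ?(ltW y1')//; by rewrite (gt_eqF y1') implybT.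
  set P := (1 - y) `^ _.
  transitivity (P * (a * (1 - (bin_sum n.+1).[y]) - (1 - y) * ((bin_sum n.+1)^`()).[y])); first by ring.
  by rewrite ode; ring.
have h0 n : h n 0 = 1.
  rewrite /h subr0 powR1 mulr1 /bin_sum horner_sum big1 ?subr0// => i _.
  by rewrite !hornerE expr0n/= mulr0.
have xlt : 0 < 1 - x by rewrite subr_gt0.
pose M := a * (1 - x) `^ (- a - 1) * x.
have bnd n : 1 <= h n x <= 1 + M * x ^+ n.+1.
  have [||c /[!in_itv]/= /andP[c0 cx]] := @MVT_segment R (h n) (dh n) 0 x x0.
  - by move=> c; rewrite in_itv/= => /andP[_ cx]; apply: dhE; exact: lt_trans cx x1.
  - apply: derivable_within_continuous => c /[!in_itv]/= /andP[_ cx].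
    by apply: ex_derive; exact/dhE/(le_lt_trans cx).
  rewrite h0 subr0 => /eqP; rewrite subr_eq addrC => /eqP ->.
  have c1 : 0 < 1 - c by rewrite subr_gt0 (le_lt_trans cx).
  have na0 : 0 <= n.+1%:R - a by rewrite subr_ge0 (le_trans a1)// ler1n.
  rewrite lerDl lerD2l; apply/andP; split.
    by rewrite !mulr_ge0// ?bin_coeff_ge0 ?exprn_ge0 ?powR_ge0.
  rewrite /M -[leRHS]mulrA [x * _]mulrC mulrA ler_wpM2r//.
  rewrite /dh [leRHS]mulrAC; apply: ler_pM.
  - by rewrite !mulr_ge0// ?bin_coeff_ge0 ?exprn_ge0.
  - exact: powR_ge0.
  - apply: ler_pM; rewrite ?exprn_ge0 ?mulr_ge0// ?bin_coeff_ge0//.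
      by apply: le_trans (bin_coeff_le n); rewrite ler_wpM2r ?bin_coeff_ge0// gerBl ltW.
    by rewrite lerXn2r// nnegrE.
  - rewrite -opprD !powRN lef_pV2 ?posrE ?powR_gt0//.
    apply: ge0_ler_powR; rewrite ?nnegrE ?(ltW xlt) ?(ltW c1)//.
      by rewrite addr_ge0// ltW.
    by rewrite lerD2l lerN2.
have hcv : h n x @[n --> \oo] --> (1 : R).
  have M0 : 1 + M * x ^+ n.+1 @[n --> \oo] --> (1 : R).
    rewrite -[X in _ --> X]addr0 -[X in _ + X](mulr0 M).
    apply: cvgD; first exact: cvg_cst.
    apply: cvgM; first exact: cvg_cst.
    rewrite (cvg_shiftS (fun n => x ^+ n)); apply: cvg_expr.
    by rewrite ger0_norm.
  refine (squeeze_cvgr _ (cvg_cst (1 : R)) M0).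
  by near=> n; exact: bnd.
have -> : (fun n => (bin_sum n.+1).[x]) = (fun n => 1 - h n x * (1 - x) `^ a).
  apply/funext => n; rewrite /h -mulrA -powRD ?addNr; last first.
    by rewrite (gt_eqF xlt) implybT.
  by rewrite powRr0 mulr1 subKr.
rewrite -[(1 - x) `^ a in X in _ --> X]mul1r.
apply: cvgB; first exact: cvg_cst.
by apply: cvgM => //; exact: cvg_cst.
Unshelve. all: by end_near. Qed.

End binomial_series.

(** * Positive definite kernels and Schoenberg's theorem *)

Section positive_definite.
Context {R : realType} {T : Type}.
Implicit Types (k : T -> T -> R) (s : seq (R * T)).

Definition mass s : R := \sum_(u <- s) u.1.

Definition qform k s : R :=
  \sum_(u <- s) \sum_(v <- s) u.1 * v.1 * k u.2 v.2.

(* [psd_mass sigma k]: [k] is positive semidefinite on finitely supported signed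
   measures of total mass in [sigma]; [setT] and [set 0] give positive definite
   and conditionally positive definite kernels. *)
Definition psd_mass (sigma : set R) k : Prop :=
  forall s, sigma (mass s) -> 0 <= qform k s.

Lemma qformD k1 k2 s :
  qform (fun x y => k1 x y + k2 x y) s = qform k1 s + qform k2 s.
Proof.
rewrite /qform -big_split; apply: eq_bigr => u _.
by rewrite -big_split; apply: eq_bigr => v _; rewrite mulrDr.
Qed.

Lemma qformZ c k s : qform (fun x y => c * k x y) s = c * qform k s.
Proof.
rewrite /qform mulr_sumr; apply: eq_bigr => u _.
by rewrite mulr_sumr; apply: eq_bigr => v _; rewrite mulrCA.
Qed.

Lemma qform_cst c s : qform (fun _ _ => c) s = c * mass s ^+ 2.
Proof.
rewrite expr2 /qform /mass mulr_suml mulr_sumr; apply: eq_bigr => u _.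
rewrite [c * _]mulrC !mulr_sumr mulr_suml; apply: eq_bigr => v _.
by rewrite -!mulrA.
Qed.

Lemma qform_rank1 (f : T -> R) s :
  qform (fun x y => f x * f y) s = (\sum_(u <- s) u.1 * f u.2) ^+ 2.
Proof.
rewrite expr2 mulr_suml; apply: eq_bigr => u _.
by rewrite mulr_sumr; apply: eq_bigr => v _; ring.
Qed.

Lemma cvg_sum_seq (I : Type) (r : seq I) (F : nat -> I -> R) (l : I -> R) :
  (forall i, F n i @[n --> \oo] --> l i) ->
  \sum_(i <- r) F n i @[n --> \oo] --> \sum_(i <- r) l i.
Proof.
move=> Fl; elim: r => [|i r IH].
  by under eq_fun do rewrite big_nil; rewrite big_nil; exact: cvg_cst.
by under eq_fun do rewrite big_cons; rewrite big_cons; exact: cvgD.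
Qed.

Lemma psd_mass_cvg sigma (kn : nat -> T -> T -> R) k :
  (forall n, psd_mass sigma (kn n)) ->
  (forall x y, kn n x y @[n --> \oo] --> k x y) -> psd_mass sigma k.
Proof.
move=> kn0 knk s ss.
have qc : qform (kn n) s @[n --> \oo] --> qform k s.
  apply: cvg_sum_seq => u; apply: cvg_sum_seq => v.
  by apply: cvgM; [exact: cvg_cst|exact: knk].
rewrite -(cvg_lim (@Rhausdorff R) qc).
apply: limr_ge; first by apply: cvgP qc.
by near=> n; exact: kn0.
Unshelve. all: by end_near. Qed.

Lemma psd_massD sigma k1 k2 : psd_mass sigma k1 -> psd_mass sigma k2 ->
  psd_mass sigma (fun x y => k1 x y + k2 x y).
Proof. by move=> h1 h2 s ss; rewrite qformD addr_ge0 ?h1 ?h2. Qed.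

Lemma psd_massZ sigma c k : 0 <= c -> psd_mass sigma k ->
  psd_mass sigma (fun x y => c * k x y).
Proof. by move=> c0 h s ss; rewrite qformZ mulr_ge0 ?h. Qed.

Lemma psd_mass_sum sigma (I : Type) (r : seq I) (k : I -> T -> T -> R) :
  (forall i, psd_mass sigma (k i)) ->
  psd_mass sigma (fun x y => \sum_(i <- r) k i x y).
Proof.
move=> h; elim: r => [|i r IH] s ss.
  under eq_fun do under eq_fun do rewrite big_nil.
  by rewrite qform_cst mul0r.
under eq_fun do under eq_fun do rewrite big_cons.
by apply: (psd_massD (h i) IH).
Qed.

Lemma psd_mass_rank1 sigma (f : T -> R) :
  psd_mass sigma (fun x y => f x * f y).
Proof. by move=> s _; rewrite qform_rank1 sqr_ge0. Qed.

(** The factor [f] is absorbed into the weights. This changes the total mass, hence the restriction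
    to [setT]. *)
Lemma psd_mass_congr (f : T -> R) k : psd_mass setT k ->
  psd_mass setT (fun x y => f x * f y * k x y).
Proof.
move=> kp s _; have := kp [seq (u.1 * f u.2, u.2) | u <- s] Logic.I.
rewrite /qform big_map; congr (_ <= _); apply: eq_bigr => u _.
by rewrite big_map; apply: eq_bigr => v _ /=; ring.
Qed.

End positive_definite.

Lemma psd_mass_reindex {R : realType} {T U : Type} (f : U -> T) sigma
    (k : T -> T -> R) : psd_mass sigma k ->
  psd_mass sigma (fun x y => k (f x) (f y)).
Proof.
move=> kp s ss; have := kp [seq (u.1, f u.2) | u <- s].
rewrite /qform /mass !big_map => /(_ ss).
by congr (_ <= _); apply: eq_bigr => u _; rewrite big_map.
Qed.

(** * Gaussian kernels and powers of the Euclidean distance *)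

Section gaussian.
Context {R : realType} {d : nat}.
Local Notation E := (d.-tuple R).
Implicit Types x y : E.

Definition inner x y : R := \sum_(i < d) tnth x i * tnth y i.

Definition sqdist x y : R := \sum_(i < d) (tnth x i - tnth y i) ^+ 2.

Lemma sqdist_ge0 x y : 0 <= sqdist x y.
Proof. by rewrite sumr_ge0// => i _; exact: sqr_ge0. Qed.

Lemma dist2_powR x y beta : dist2 x y `^ beta = sqdist x y `^ (beta / 2).
Proof.
rewrite /dist2 /norm2.
under eq_bigr do rewrite tnth_mktuple.
by rewrite -/(sqdist x y) -powR12_sqrt ?sqdist_ge0// -powRrM mulrC.
Qed.

Lemma sqdistE x y : sqdist x y = inner x x + inner y y - 2 * inner x y.
Proof.
rewrite /sqdist /inner mulr_sumr -big_split -sumrB; apply: eq_bigr => i _ /=.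
by ring.
Qed.

(** Expanding the power gives the coordinates of the n-th tensor power, indexed by [f]: a sum of
    rank-one kernels. *)
Lemma psd_inner_exp n : psd_mass setT (fun x y => inner x y ^+ n).
Proof.
have -> : (fun x y => inner x y ^+ n) =
    (fun x y => \sum_(f : {ffun 'I_n -> 'I_d})
       \prod_(l < n) tnth x (f l) * \prod_(l < n) tnth y (f l)).
  apply/funext => x; apply/funext => y.
  rewrite -[n in LHS]card_ord -prodr_const bigA_distr_bigA.
  by apply: eq_bigr => f _; rewrite big_split.
by apply: psd_mass_sum => f; exact: psd_mass_rank1.
Qed.

(** Up to a factor of the form [f x * f y], the Gaussian is the exponential of the inner product,
    whose power series has nonnegative coefficients. *)
Lemma psd_gaussian t : 0 <= t -> psd_mass setT (fun x y => expR (- (t * sqdist x y))).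
Proof.
move=> t0.
have -> : (fun x y => expR (- (t * sqdist x y))) = (fun x y =>
    expR (- (t * inner x x)) * expR (- (t * inner y y)) * expR (2 * t * inner x y)).
  apply/funext => x; apply/funext => y; rewrite -!expRD sqdistE; congr expR; ring.
apply: (@psd_mass_congr _ _ (fun x => expR (- (t * inner x x)))).
apply: (@psd_mass_cvg _ _ _ (fun n x y =>
  \sum_(0 <= k < n) (2 * t) ^+ k / k`!%:R * inner x y ^+ k)) => [n|x y].
  apply: psd_mass_sum => k; apply: psd_massZ; last exact: psd_inner_exp.
  by rewrite divr_ge0// exprn_ge0// mulr_ge0.
rewrite (_ : (fun _ => _) = series (exp_coeff (2 * t * inner x y))).
  exact: is_cvg_series_exp_coeff.
apply/funext => n; apply: eq_bigr => k _.
by rewrite /exp_coeff/= [in RHS]exprMn mulrAC.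
Qed.

(* [- (1 - exp (- s r))^a] is a constant plus a nonnegative combination of
   Gaussians; dividing by [s^a] and letting [s] and [eta] tend to 0 yields
   [- r^a]. *)
Lemma cpsd_expR a s eta : 0 < a <= 1 -> 0 < s -> 0 < eta ->
  psd_mass [set 0] (fun x y => - (1 - expR (- (s * (sqdist x y + eta)))) `^ a).
Proof.
move=> a01 s0 eta0.
(* [eta] keeps this value strictly below 1 even at [x = y], as [cvg_bin_sum] requires. *)
have e1 x y : 0 <= expR (- (s * (sqdist x y + eta))) < 1.
  rewrite expR_ge0/= -expR0 ltr_expR oppr_lt0 mulr_gt0//.
  by rewrite ltr_wpDl ?sqdist_ge0.
apply: (@psd_mass_cvg _ _ _ (fun n x y => -1 +
   (bin_sum a n.+1).[expR (- (s * (sqdist x y + eta)))])) => [n|x y]; last first.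
  have -> : - (1 - expR (- (s * (sqdist x y + eta)))) `^ a =
    -1 + (1 - (1 - expR (- (s * (sqdist x y + eta)))) `^ a) by rewrite addKr.
  by apply: cvgD; [exact: cvg_cst|exact: cvg_bin_sum].
apply: psd_massD.
  by move=> u /= u0; rewrite qform_cst u0 expr0n mulr0.
have -> : (fun x y => (bin_sum a n.+1).[expR (- (s * (sqdist x y + eta)))]) =
  (fun x y => \sum_(k < n.+1) (bin_coeff a k * expR (- (s * eta)) ^+ k.+1 *
     expR (- ((k.+1%:R * s) * sqdist x y)))).
  apply/funext => x; apply/funext => y; rewrite horner_sum; apply: eq_bigr => k _.
  rewrite !hornerE -!expRM_natl -mulrA -expRD; congr (_ * expR _); ring.
apply: psd_mass_sum => k; apply: psd_massZ.
  by rewrite mulr_ge0 ?bin_coeff_ge0 ?exprn_ge0 ?expR_ge0.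
by move=> u _; apply: psd_gaussian => //; rewrite mulr_ge0// ltW.
Qed.

Lemma cvg_expR_quotient (y : R) : 0 <= y ->
  n.+1%:R * (1 - expR (- (n.+1%:R^-1 * y))) @[n --> \oo] --> y.
Proof.
move=> y0.
have lo : y * (1 + n.+1%:R^-1 * y)^-1 @[n --> \oo] --> y * (1 + 0 * y)^-1.
  apply: cvgM; first exact: cvg_cst.
  apply: cvgV; first by rewrite mul0r addr0 oner_neq0.
  apply: cvgD; first exact: cvg_cst.
  by apply: cvgM; [exact: cvg_harmonic|exact: cvg_cst].
rewrite mul0r addr0 invr1 mulr1 in lo.
refine (squeeze_cvgr _ lo (cvg_cst y)).
near=> n; set t := n.+1%:R^-1; have t0 : 0 < t by rewrite invr_gt0.
have tn : n.+1%:R = t^-1 by rewrite invrK.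
have ty0 : 0 <= t * y by rewrite mulr_ge0// ltW.
rewrite tn; apply/andP; split.
  have -> : y / (1 + t * y) = t^-1 * (1 - (1 + t * y)^-1).
    by field; rewrite !gt_eqF//; lra.
  rewrite ler_wpM2l ?invr_ge0 ?(ltW t0)// lerD2l lerN2 expRN.
  by rewrite lef_pV2 ?posrE ?expR_gt0 ?expR_ge1Dx//; lra.
rewrite ler_pdivrMl//.
by have := expR_ge1Dx (- (t * y)); lra.
Unshelve. all: by end_near. Qed.

Lemma cvg_powR (u : nat -> R) (l a : R) : 0 < l -> u n @[n --> \oo] --> l ->
  u n `^ a @[n --> \oo] --> l `^ a.
Proof.
move=> l0; move=> ul'; have : {for l, continuous (fun x : R => x `^ a)}.
  apply/differentiable_continuous/derivable1_diffP/derivable_powR.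
  by rewrite in_itv/= l0.
by move=> /continuous_cvg; apply.
Qed.

Lemma cpsd_sqdist_powR a : 0 < a <= 1 ->
  psd_mass [set 0] (fun x y => - sqdist x y `^ a).
Proof.
move=> a01; have /andP[a0 a1] := a01.
have step eta : 0 < eta ->
    psd_mass [set 0] (fun x y => - (sqdist x y + eta) `^ a).
  move=> eta0; apply: (@psd_mass_cvg _ _ _ (fun n x y =>
    n.+1%:R `^ a * - (1 - expR (- (n.+1%:R^-1 * (sqdist x y + eta)))) `^ a)).
    by move=> n; apply: psd_massZ; [exact: powR_ge0|apply: cpsd_expR].
  move=> x y; have xy0 : 0 < sqdist x y + eta by rewrite ltr_wpDl ?sqdist_ge0.
  under eq_fun => n.
    rewrite mulrN -powRM//; last first.
      by rewrite subr_ge0 -expR0 ler_expR oppr_le0 mulr_ge0// ltW.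
    over.
  by apply: cvgN; apply: cvg_powR => //; apply: cvg_expR_quotient; exact: ltW.
apply: (@psd_mass_cvg _ _ _ (fun n x y => - (sqdist x y + n.+1%:R^-1) `^ a)).
  by move=> n; exact: step.
move=> x y; apply: cvgN; have := sqdist_ge0 x y.
rewrite le_eqVlt => /orP[/eqP <-|xy0]; last first.
  have -> : sqdist x y `^ a = (sqdist x y + 0) `^ a by rewrite addr0.
  apply: cvg_powR; first by rewrite addr0.
  by apply: cvgD; [exact: cvg_cst|exact: cvg_harmonic].
(* Where the distance vanishes, [cvg_powR] does not apply; the right limit of the power at 0
   replaces it. *)
rewrite powR0 ?gt_eqF//; under eq_fun do rewrite add0r.
have /cvg_at_rightP := powR_cvg0 a0; apply.
by split=> [n|]; [rewrite invr_gt0|exact: cvg_harmonic].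
Qed.

End gaussian.

(** * Integrals of bounded measurable functions *)

Section bounded_measurable.
Context {d : measure_display} {T : measurableType d} {R : realType}.
Implicit Types (f g : T -> R) (P : probability T R).

(** All integrands are first extended to bounded functions on the whole space, so that this class,
    closed under the operations used, settles integrability against any probability. *)
Definition bdmeas f : Prop :=
  measurable_fun setT f /\ exists M : R, forall x, `|f x| <= M.

Lemma bdmeas_cst (c : R) : bdmeas (fun _ => c).
Proof. by split; [exact: measurable_cst|exists `|c|]. Qed.

Lemma bdmeasD f g : bdmeas f -> bdmeas g -> bdmeas (fun x => f x + g x).
Proof.
move=> [mf [M fM]] [mg [N gN]]; split; first exact: measurable_funD.
by exists (M + N) => x; rewrite (le_trans (ler_normD _ _))// lerD.
Qed.

Lemma bdmeasM f g : bdmeas f -> bdmeas g -> bdmeas (fun x => f x * g x).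
Proof.
move=> [mf [M fM]] [mg [N gN]]; split; first exact: measurable_funM.
by exists (M * N) => x; rewrite normrM ler_pM.
Qed.

Lemma bdmeasN f : bdmeas f -> bdmeas (fun x => - f x).
Proof.
move=> [mf [M fM]]; split; first exact: measurableT_comp.
by exists M => x; rewrite normrN.
Qed.

Lemma bdmeasB f g : bdmeas f -> bdmeas g -> bdmeas (fun x => f x - g x).
Proof. by move=> bf bg; apply: bdmeasD => //; exact: bdmeasN. Qed.

Lemma bdmeasZ (c : R) f : bdmeas f -> bdmeas (fun x => c * f x).
Proof. by move=> bf; apply: bdmeasM => //; exact: bdmeas_cst. Qed.

Lemma bdmeas_sum (I : Type) (r : seq I) (f : I -> T -> R) :
  (forall i, bdmeas (f i)) -> bdmeas (fun x => \sum_(i <- r) f i x).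
Proof.
move=> bf; elim: r => [|i r IH].
  by under eq_fun do rewrite big_nil; exact: bdmeas_cst.
by under eq_fun do rewrite big_cons; exact: bdmeasD.
Qed.

Lemma bdmeas_integrable P f : bdmeas f -> P.-integrable setT (EFin \o f).
Proof.
move=> [mf [M fM]]; apply: measurable_bounded_integrable => //.
  by rewrite -ge0_fin_numE// fin_num_measure.
exists M; split; first by rewrite num_real.
by move=> x Mx y _ /=; rewrite (le_trans (fM y))// ltW.
Qed.

Lemma RintegralD_bd P f g : bdmeas f -> bdmeas g ->
  \int[P]_x (f x + g x) = \int[P]_x f x + \int[P]_x g x.
Proof. by move=> *; rewrite RintegralD//; exact: bdmeas_integrable. Qed.

Lemma RintegralB_bd P f g : bdmeas f -> bdmeas g ->
  \int[P]_x (f x - g x) = \int[P]_x f x - \int[P]_x g x.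
Proof. by move=> *; rewrite RintegralB//; exact: bdmeas_integrable. Qed.

Lemma RintegralZ_bd P (c : R) f : bdmeas f ->
  \int[P]_x (c * f x) = c * \int[P]_x f x.
Proof. by move=> *; rewrite RintegralZl//; exact: bdmeas_integrable. Qed.

Lemma Rintegral_cst_bd P (c : R) : \int[P]_x c = c.
Proof.
rewrite Rintegral_cst// -[RHS]mulr1; congr (_ * _).
by rewrite -[RHS]/(fine 1%E); congr fine; exact: probability_setT.
Qed.

Lemma Rintegral_sum_bd P (I : Type) (r : seq I) (f : I -> T -> R) :
  (forall i, bdmeas (f i)) ->
  \int[P]_x (\sum_(i <- r) f i x) = \sum_(i <- r) \int[P]_x f i x.
Proof.
move=> bf; elim: r => [|i r IH].
  by under eq_Rintegral do rewrite big_nil; rewrite big_nil Rintegral_cst_bd.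
under eq_Rintegral do rewrite big_cons.
by rewrite big_cons RintegralD_bd// ?IH//; exact: bdmeas_sum.
Qed.

Lemma le_Rintegral_bd P f g : bdmeas f -> bdmeas g -> (forall x, f x <= g x) ->
  \int[P]_x f x <= \int[P]_x g x.
Proof. by move=> *; apply: le_Rintegral => //; exact: bdmeas_integrable. Qed.

Lemma le_Rintegral_norm P f (M : R) : bdmeas f -> (forall x, `|f x| <= M) ->
  `|\int[P]_x f x| <= M.
Proof.
move=> bf fM; rewrite ler_norml; apply/andP; split.
  rewrite -(Rintegral_cst_bd P (- M)); apply: le_Rintegral_bd => //.
    exact: bdmeas_cst.
  by move=> x; have := fM x; rewrite ler_norml => /andP[].
rewrite -[in leRHS](Rintegral_cst_bd P M); apply: le_Rintegral_bd => //.
  exact: bdmeas_cst.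
by move=> x; have := fM x; rewrite ler_norml => /andP[].
Qed.

End bounded_measurable.

Lemma bdmeas_comp {d d'} {T : measurableType d} {U : measurableType d'}
    {R : realType} (g : U -> R) (f : T -> U) :
  bdmeas g -> measurable_fun setT f -> bdmeas (g \o f).
Proof. by move=> [mg [M gM]] mf; split; [exact: measurableT_comp|exists M => x; exact: gM]. Qed.

Section kernel_integral.
Context {d1 d2 : measure_display} {V : measurableType d1} {T : measurableType d2}
  {R : realType}.
Variable l : V -> probability T R.
Hypothesis ml : forall A, measurable A -> measurable_fun setT (fun v => l v A).

Definition prob_kernel_of (v : V) : {measure set T -> \bar R} := l v.

HB.instance Definition _ :=
  isKernel.Build _ _ V T R prob_kernel_of ml.

HB.instance Definition _ := Kernel_isProbability.Build _ _ V T R prob_kernel_of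
  (fun v => probability_setT (l v)).

Lemma bdmeas_kernel (f : V * T -> R) : bdmeas f ->
  bdmeas (fun v => \int[l v]_y f (v, y)).
Proof.
move=> [mf [M fM]].
have bfv v : bdmeas (fun y => f (v, y)).
  by split; [exact: measurableT_comp|exists M].
split; last by exists M => v; exact: le_Rintegral_norm.
(* Shifting by [M] reduces to a nonnegative integrand. *)
have -> : (fun v => \int[l v]_y f (v, y)) =
    (fun v => fine (\int[prob_kernel_of v]_y (f (v, y) + M)%:E) - M).
  apply/funext => v; rewrite -[fine _]/(\int[l v]_y (f (v, y) + M)).
  by rewrite RintegralD_bd ?Rintegral_cst_bd ?addrK//; exact: bdmeas_cst.
apply: measurable_funB; last exact: measurable_cst.
apply: measurableT_comp => //.
apply: (measurable_fun_integral_finite_kernel (fun z => (f z + M)%:E)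
  prob_kernel_of) => [z|].
  by rewrite lee_fin -lerBlDr sub0r; have := fM z; rewrite ler_norml => /andP[].
by apply/measurable_EFinP; apply: measurable_funD => //; exact: measurable_cst.
Qed.

End kernel_integral.

(** * Centered kernels *)

Lemma discriminant_le {R : realFieldType} (a b c : R) : 0 <= a ->
  (forall u, 0 <= u ^+ 2 * a + 2 * u * b + c) -> b ^+ 2 <= a * c.
Proof.
move=> a0 h; have [a_eq0|a_neq0] := eqVneq a 0.
  have [->|b0] := eqVneq b 0; first by rewrite a_eq0 expr0n mul0r.
  (* With [a = 0] the form is affine in [u], and at this point it takes the value -1. *)
  have := h (- (c + 1) / (2 * b)); rewrite a_eq0 mulr0 add0r.
  have -> : 2 * (- (c + 1) / (2 * b)) * b = - (c + 1) by field.
  by lra.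
have agt0 : 0 < a by rewrite lt_def a_neq0.
have := h (- b / a).
have -> : (- b / a) ^+ 2 * a + 2 * (- b / a) * b + c = c - b ^+ 2 / a by field.
by rewrite subr_ge0 ler_pdivrMr// mulrC.
Qed.

Lemma ge0_of_harmonic {R : realType} (x y : R) :
  (forall n : nat, 0 <= x + y * n.+1%:R^-1) -> 0 <= x.
Proof.
move=> h; have c : x + y * n.+1%:R^-1 @[n --> \oo] --> x + y * 0.
  apply: cvgD; first exact: cvg_cst.
  by apply: cvgM; [exact: cvg_cst|exact: cvg_harmonic].
rewrite mulr0 addr0 in c.
rewrite -(cvg_lim (@Rhausdorff R) c); apply: limr_ge; first by apply: cvgP c.
by near=> n; exact: h.
Unshelve. all: by end_near. Qed.

Section qform_cons.
Context {R : realType} {T : Type}.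
Variable k : T -> T -> R.
Hypothesis ksym : forall x y, k x y = k y x.

Lemma mass_cons (u : R * T) s : mass (u :: s) = u.1 + mass s.
Proof. by rewrite /mass big_cons. Qed.

Lemma qform_cons (u : R * T) s : qform k (u :: s) =
  u.1 ^+ 2 * k u.2 u.2 + 2 * u.1 * (\sum_(v <- s) v.1 * k u.2 v.2) + qform k s.
Proof.
rewrite /qform big_cons.
under [X in _ + X]eq_bigr do rewrite big_cons.
rewrite big_cons big_split/= -expr2 -!addrA; congr (_ + _).
rewrite addrA; congr (_ + _).
have -> : \sum_(v <- s) u.1 * v.1 * k u.2 v.2 = u.1 * \sum_(v <- s) v.1 * k u.2 v.2.
  by rewrite mulr_sumr; apply: eq_bigr => v _; rewrite mulrA.
have -> : \sum_(v <- s) v.1 * u.1 * k v.2 u.2 = u.1 * \sum_(v <- s) v.1 * k u.2 v.2.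
  by rewrite mulr_sumr; apply: eq_bigr => v _; rewrite ksym mulrCA mulrA.
by ring.
Qed.

(** Discriminant of the form in the weight [u] of an extra atom at [x]. *)
Lemma psd_mass_CauchySchwarz (x : T) s : psd_mass setT k ->
  (\sum_(v <- s) v.1 * k x v.2) ^+ 2 <= k x x * qform k s.
Proof.
move=> kp; apply: discriminant_le.
  have := kp [:: (1, x)] Logic.I.
  by rewrite /qform !big_seq1/= !mul1r.
by move=> u; have := kp ((u, x) :: s) Logic.I; rewrite qform_cons.
Qed.

End qform_cons.

Section centered_kernel.
Context {d : measure_display} {T : measurableType d} {R : realType}.
Variables (P0 : probability T R) (k : T -> T -> R).
Hypothesis bk : bdmeas (fun z : T * T => k z.1 z.2).
Hypothesis ksym : forall x y, k x y = k y x.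

Definition mean_embedding (y : T) : R := \int[P0]_x k x y.
Local Notation m0 := mean_embedding.

Definition mean_energy : R := \int[P0]_y m0 y.
Local Notation K0 := mean_energy.

Definition centered (x y : T) : R := k x y - m0 x - m0 y + K0.

Lemma bdmeas_section x : bdmeas (fun y => k y x).
Proof. exact: (bdmeas_comp bk (pair2_measurable x)). Qed.

Lemma bdmeas_mean_embedding : bdmeas m0.
Proof.
have -> : m0 = (fun x => \int[P0]_y k x y).
  by apply/funext => x; apply: eq_Rintegral => y _; rewrite ksym.
exact: (@bdmeas_kernel _ _ _ _ _ (fun _ : T => P0)
  (fun A mA => measurable_cst _) (fun z => k z.1 z.2)).
Qed.

(** The expression bounds the mean of [qform] after adding [n] independent atoms of law [P0] and
    weight [a] to [s], the diagonal terms being replaced by [M]. In the induction one atom [z] joins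
    [s], which keeps the total mass [r], and is then integrated out. *)
Lemma psd_mass_integral_aux r M : (forall x, k x x <= M) -> psd_mass [set r] k ->
  forall (n : nat) s a, mass s + n%:R * a = r ->
  0 <= qform k s + 2 * a * n%:R * (\sum_(u <- s) u.1 * m0 u.2) +
       a ^+ 2 * (n%:R * (n%:R - 1) * K0 + n%:R * M).
Proof.
move=> kM kp; elim => [|n IH] s a mr.
  rewrite !mul0r addr0 mulr0 mul0r addr0 mulr0 addr0.
  by apply: kp; move: mr; rewrite mul0r addr0.
pose B := \sum_(u <- s) u.1 * m0 u.2.
pose A := qform k s + a ^+ 2 * M + 2 * a * n%:R * B +
   a ^+ 2 * (n%:R * (n%:R - 1) * K0 + n%:R * M).
pose g z := A + (2 * a * (\sum_(u <- s) u.1 * k z u.2) + 2 * a ^+ 2 * n%:R * m0 z).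
have g0 z : 0 <= g z.
  have /IH : mass ((a, z) :: s) + n%:R * a = r.
    by rewrite mass_cons -mr -natr1 /=; ring.
  rewrite qform_cons// big_cons/= => /le_trans; apply.
  rewrite -subr_ge0 [X in 0 <= X](_ : _ = a ^+ 2 * (M - k z z)).
    by rewrite mulr_ge0 ?sqr_ge0// subr_ge0.
  by rewrite /g /A -/B; ring.
have bs : bdmeas (fun z => \sum_(u <- s) u.1 * k z u.2).
  by apply: bdmeas_sum => u; apply: bdmeasZ; exact: bdmeas_section.
have : 0 <= \int[P0]_z g z by exact: Rintegral_ge0.
rewrite RintegralD_bd; last 2 first.
  exact: bdmeas_cst.
  by apply: bdmeasD; apply: bdmeasZ => //; exact: bdmeas_mean_embedding.
rewrite Rintegral_cst_bd RintegralD_bd; last 2 first.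
  exact: bdmeasZ.
  by apply: bdmeasZ; exact: bdmeas_mean_embedding.
rewrite !RintegralZ_bd//; last exact: bdmeas_mean_embedding.
rewrite Rintegral_sum_bd; last by move=> u; apply: bdmeasZ; exact: bdmeas_section.
under eq_bigr => u _ do rewrite (RintegralZ_bd _ _ (bdmeas_section _)).
rewrite -[\int[P0]_x m0 x]/K0 -[X in 2 * a * X]/B.
by congr (_ <= _); rewrite /A -[n.+1%:R]natr1 -/B; ring.
Qed.

(* The averages of [N] independent points of law [P0] approximate [P0]: the
   points are integrated out one at a time, and the diagonal terms are O(1/N). *)
Lemma psd_mass_integral r : psd_mass [set r] k ->
  forall s a, mass s + a = r ->
  0 <= qform k s + 2 * a * (\sum_(u <- s) u.1 * m0 u.2) + a ^+ 2 * K0.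
Proof.
move=> kp s a mr; have [_ [M kM]] := bk.
have kM' x : k x x <= M by apply: le_trans (kM (x, x)); exact: ler_norm.
apply: (@ge0_of_harmonic _ _ (a ^+ 2 * (M - K0))) => n.
have := psd_mass_integral_aux kM' kp (n := n.+1) (s := s) (a := a / n.+1%:R).
rewrite mulrC divfK ?pnatr_eq0// => /(_ mr); congr (_ <= _).
by move: (pnatr_eq0 R n.+1); case: eqVneq => //; set N := n.+1%:R => N0 _; field.
Qed.

Lemma centered_sym x y : centered x y = centered y x.
Proof. by rewrite /centered ksym; ring. Qed.

Lemma bdmeas_centered : bdmeas (fun z : T * T => centered z.1 z.2).
Proof.
apply: bdmeasD; last exact: bdmeas_cst.
apply: bdmeasB; last exact: (bdmeas_comp bdmeas_mean_embedding measurable_snd).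
apply: bdmeasB => //; exact: (bdmeas_comp bdmeas_mean_embedding measurable_fst).
Qed.

Lemma centered_mean x : \int[P0]_y centered y x = 0.
Proof.
rewrite RintegralD_bd; [|apply: bdmeasB|exact: bdmeas_cst].
- rewrite Rintegral_cst_bd RintegralB_bd ?RintegralB_bd ?Rintegral_cst_bd//.
  + by rewrite -/K0 -/(m0 x); ring.
  + exact: bdmeas_section.
  + exact: bdmeas_mean_embedding.
  + by apply: bdmeasB; [exact: bdmeas_section|exact: bdmeas_mean_embedding].
  + exact: bdmeas_cst.
- by apply: bdmeasB; [exact: bdmeas_section|exact: bdmeas_mean_embedding].
- exact: bdmeas_cst.
Qed.

(** The right-hand side is the form of [k] on the signed measure [s - mass s * P0], of total mass 0.
    This is why conditional positivity of [k] suffices in [psd_centered]. *)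
Lemma qform_centered s : qform centered s =
  qform k s + 2 * (- mass s) * (\sum_(u <- s) u.1 * m0 u.2) + (- mass s) ^+ 2 * K0.
Proof.
have -> : centered = (fun x y => k x y + ((-1) * (m0 x * 1 + 1 * m0 y) + K0)).
  by apply/funext => x; apply/funext => y; rewrite /centered; ring.
rewrite qformD qformD qformZ qform_cst sqrrN -addrA; congr (_ + _).
rewrite [K0 * _]mulrC; congr (_ + _); rewrite qformD.
have -> : qform (fun x _ : T => m0 x * 1) s = mass s * \sum_(u <- s) u.1 * m0 u.2.
  rewrite mulr_sumr; apply: eq_bigr => u _.
  by rewrite /mass !mulr_suml; apply: eq_bigr => v _; ring.
have -> : qform (fun _ y : T => 1 * m0 y) s = mass s * \sum_(u <- s) u.1 * m0 u.2.
  rewrite /mass mulr_suml; apply: eq_bigr => u _.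
  by rewrite mulr_sumr; apply: eq_bigr => v _; ring.
by ring.
Qed.

Lemma psd_centered : psd_mass [set 0] k -> psd_mass setT centered.
Proof.
move=> kp s _; rewrite qform_centered.
by apply: (psd_mass_integral kp); rewrite subrr.
Qed.

(** Cauchy-Schwarz between an atom at [x] and [s - mass s * P0]. The atom is not centered, so total
    masses [u] of every size occur; in return the first factor is [k x x] and not [centered x x]. *)
Lemma kernel_CauchySchwarz x s : psd_mass setT k ->
  (\sum_(v <- s) v.1 * (k x v.2 - m0 x)) ^+ 2 <= k x x * qform centered s.
Proof.
move=> kp.
have -> : \sum_(v <- s) v.1 * (k x v.2 - m0 x) =
    \sum_(v <- s) v.1 * k x v.2 - mass s * m0 x.
  by under eq_bigr do rewrite mulrBr; rewrite sumrB -mulr_suml.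
apply: discriminant_le.
  have := kp [:: (1, x)] Logic.I.
  by rewrite /qform !big_seq1/= !mul1r.
move=> u; have kpr : psd_mass [set u] k by move=> t _; exact: kp.
have := psd_mass_integral kpr (s := (u, x) :: s) (a := - mass s).
rewrite mass_cons/= addrK => /(_ erefl).
rewrite qform_cons// big_cons/= qform_centered; congr (_ <= _).
by ring.
Qed.

End centered_kernel.

(** * Pinelis' inequality *)

Lemma measurable_sqrtr {R : realType} : measurable_fun [set: R] (@Num.sqrt R).
Proof. by apply: continuous_measurable_fun; exact: sqrt_continuous. Qed.

Section tuple_measure_integral.
Context {d : measure_display} {T : measurableType d} {R : realType}.
Variable m : {sigma_finite_measure set T -> \bar R}.
Local Open Scope ereal_scope.

(** The new point is integrated innermost, with the other points fixed; this plays the part of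
    conditional expectation in [mgf_tuple]. *)
Lemma ge0_integral_tuple_measureS n (f : n.+1.-tuple T -> \bar R) :
  measurable_fun setT f -> (forall t, 0 <= f t) ->
  \int[tuple_measure m n.+1]_t f t =
  \int[tuple_measure m n]_t \int[m]_x f [tuple of x :: t].
Proof.
move=> mf f0.
transitivity (\int[m \x tuple_measure m n]_z f (tuple_of_pair z)).
  have := @ge0_integral_pushforward _ _ _ _ R (@tuple_of_pair _ T n)
    (measurable_tuple_of_pair (n := n)) (m \x tuple_measure m n)%E setT f measurableT mf.
  by rewrite preimage_setT => <-.
rewrite fubini_tonelli2//.
by apply: measurableT_comp => //; exact: measurable_tuple_of_pair.
Qed.

End tuple_measure_integral.

Lemma tuple_measure_setT {d : measure_display} {T : measurableType d}
    {R : realType} (P : probability T R) n : tuple_measure P n setT = 1%E.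
Proof.
have := @tuple_measure_box _ _ _ P n (fun _ => setT) (fun _ => measurableT).
rewrite (_ : [set _ | _] = setT); last by apply/seteqP; split.
by move=> ->; rewrite big1// => i _; exact: probability_setT.
Qed.

Section pinelis.
Context {d : measure_display} {T : measurableType d} {R : realType}.
Variables (P : probability T R) (k : T -> T -> R) (c : R).
Hypothesis bk : bdmeas (fun z : T * T => k z.1 z.2).
Hypothesis ksym : forall x y, k x y = k y x.
Hypothesis kpsd : psd_mass setT k.
Hypothesis kmean : forall x, \int[P]_y k y x = 0.
Hypothesis c_ge0 : 0 <= c.
Hypothesis kc : forall x, k x x <= c ^+ 2.

(** Squared seminorm of the sum of the feature vectors of the points of [s]. *)
Definition gram_sum (s : seq T) : R := qform k [seq (1, x) | x <- s].

Lemma gram_sum_ge0 s : 0 <= gram_sum s.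
Proof. exact: kpsd. Qed.

Lemma gram_sumE s : gram_sum s = \sum_(x <- s) \sum_(y <- s) k x y.
Proof.
rewrite /gram_sum /qform big_map; apply: eq_bigr => x _.
by rewrite big_map; apply: eq_bigr => y _; rewrite !mul1r.
Qed.

Lemma gram_sum_cons x s :
  gram_sum (x :: s) = k x x + 2 * (\sum_(y <- s) k x y) + gram_sum s.
Proof.
rewrite /gram_sum/= qform_cons//= expr1n mul1r mulr1 big_map.
by under eq_bigr do rewrite mul1r.
Qed.

Lemma measurable_gram_sum n : measurable_fun setT (fun t : n.-tuple T => gram_sum t).
Proof.
under eq_fun => t.
  rewrite gram_sumE big_tuple; under eq_bigr do rewrite big_tuple; over.
apply: measurable_sum => i; apply: measurable_sum => j.
have mij : measurable_fun setT (fun t : n.-tuple T => (tnth t i, tnth t j)).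
  by apply: measurable_fun_pair; exact: measurable_tnth.
by case: (bdmeas_comp bk mij).
Qed.

Lemma row_sum_le x s : `|\sum_(y <- s) k x y| <= Num.sqrt (gram_sum s) * c.
Proof.
have := psd_mass_CauchySchwarz ksym x [seq (1, x) | x <- s] kpsd.
rewrite big_map; under eq_bigr do rewrite mul1r.
rewrite -/(gram_sum s) => h; rewrite -[X in _ <= _ * X](ger0_norm c_ge0).
rewrite -sqrtr_sqr -(sqrtr_sqr c) -sqrtrM ?gram_sum_ge0// ler_wsqrtr//.
by rewrite (le_trans h)// mulrC ler_wpM2l ?gram_sum_ge0.
Qed.

(** A new point [x] adds [k x x <= c ^+ 2] and twice a row sum to the squared norm. The row sum is
    at most [c] times the old norm and has mean 0 by [kmean], so the affine majorant of
    [cosh_two_point] integrates to its constant term. *)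
Lemma mgf_step (lam : R) s : 0 <= lam ->
  (\int[P]_x (cosh (lam * Num.sqrt (gram_sum (x :: s))))%:E <=
   (cosh (lam * Num.sqrt (gram_sum s)) * cosh (lam * c))%:E)%E.
Proof.
move=> lam0; pose a := Num.sqrt (gram_sum s).
have a2 : a ^+ 2 = gram_sum s by rewrite sqr_sqrtr ?gram_sum_ge0.
have [D hD] := @cosh_two_point R (lam * a) (lam * c)
  (mulr_ge0 lam0 (sqrtr_ge0 _)) (mulr_ge0 lam0 c_ge0).
pose z x := lam ^+ 2 * \sum_(y <- s) k x y.
pose A := cosh (lam * a) * cosh (lam * c).
have bsec y : bdmeas (fun x => k x y) by exact: bdmeas_section.
have bz : bdmeas z by apply: bdmeasZ; apply: bdmeas_sum.
have bAz : bdmeas (fun x => A + D * z x).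
  by apply: bdmeasD; [exact: bdmeas_cst|exact: bdmeasZ].
have pw x : cosh (lam * Num.sqrt (gram_sum (x :: s))) <= A + D * z x.
  apply: hD.
    rewrite /z normrM ger0_norm ?sqr_ge0// mulrACA -expr2.
    by rewrite ler_wpM2l ?sqr_ge0// row_sum_le.
  rewrite !exprMn sqr_sqrtr ?gram_sum_ge0// a2 gram_sum_cons /z.
  rewrite (mulrCA 2) -!mulrDr ler_wpM2l ?sqr_ge0//.
  by have := kc x; lra.
have mcosh : measurable_fun setT (fun x => cosh (lam * Num.sqrt (gram_sum (x :: s)))).
  apply: measurableT_comp; first exact: measurable_cosh.
  apply: measurable_funM; first exact: measurable_cst.
  apply: measurableT_comp; first exact: measurable_sqrtr.
  under eq_fun do rewrite gram_sum_cons.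
  apply: measurable_funD; last exact: measurable_cst.
  apply: measurable_funD.
    have mdiag : measurable_fun setT (fun x : T => (x, x)).
      by apply: measurable_fun_pair; exact: measurable_id.
    by case: (bdmeas_comp bk mdiag).
  apply: measurable_funM; first exact: measurable_cst.
  by apply: measurable_sum => y; case: (bsec y).
apply: (@le_trans _ _ (\int[P]_x (A + D * z x)%:E)%E).
  apply: ge0_le_integral => //.
  - by move=> x _; rewrite lee_fin ltW// cosh_gt0.
  - exact/measurable_EFinP.
  - by apply/measurable_EFinP; case: bAz.
  - by move=> x _; rewrite lee_fin.
have iAz := bdmeas_integrable P bAz.
rewrite -[X in (X <= _)%E](fineK (integrable_fin_num _ iAz))// lee_fin.
rewrite -[leLHS]/(\int[P]_x (A + D * z x)) RintegralD_bd//; last 2 first.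
  exact: bdmeas_cst.
  exact: bdmeasZ.
rewrite Rintegral_cst_bd RintegralZ_bd// RintegralZ_bd; last exact: bdmeas_sum.
rewrite Rintegral_sum_bd//; under eq_bigr do rewrite kmean.
by rewrite big1// !mulr0 addr0.
Qed.

Lemma measurable_cosh_gram lam n : measurable_fun setT
  (fun t : n.-tuple T => (cosh (lam * Num.sqrt (gram_sum t)))%:E).
Proof.
apply/measurable_EFinP; apply: measurableT_comp; first exact: measurable_cosh.
apply: measurable_funM; first exact: measurable_cst.
by apply: measurableT_comp; [exact: measurable_sqrtr|exact: measurable_gram_sum].
Qed.

Lemma mgf_tuple (lam : R) n : 0 <= lam ->
  (\int[tuple_measure P n]_t (cosh (lam * Num.sqrt (gram_sum t)))%:E <=
   (cosh (lam * c) ^+ n)%:E)%E.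
Proof.
move=> lam0; have mcosh := measurable_cosh_gram lam.
have cosh0 (x : R) : (0 <= (cosh x)%:E)%E by rewrite lee_fin ltW// cosh_gt0.
elim: n => [|n IH].
  rewrite [X in (X <= _)%E](_ : _ = (cosh (lam * Num.sqrt (gram_sum [::])))%:E); last first.
    by rewrite (integral_dirac _ _ (mcosh 0)) // -[RHS]mul1e; congr (_ * _)%E; exact: diracT.
  rewrite gram_sumE big_nil sqrtr0 mulr0 expr0 lee_fin.
  by rewrite /cosh oppr0 expR0; lra.
rewrite ge0_integral_tuple_measureS//.
apply: (@le_trans _ _ (\int[tuple_measure P n]_t
   ((cosh (lam * Num.sqrt (gram_sum t)))%:E * (cosh (lam * c))%:E))%E).
  apply: ge0_le_integral => //.
  - by move=> t _; apply: integral_ge0.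
  - have mz : measurable_fun setT (fun z : T * n.-tuple T =>
        (cosh (lam * Num.sqrt (gram_sum (tuple_of_pair z))))%:E).
      by apply: (measurableT_comp (mcosh n.+1)); exact: measurable_tuple_of_pair.
    exact: (measurable_fun_fubini_tonelli_G (m1 := P) _ mz (fun z => cosh0 _)).
  - by apply: emeasurable_funM; [exact: mcosh|exact: measurable_cst].
  - by move=> t _; rewrite -EFinM; exact: mgf_step.
rewrite ge0_integralZr//; last exact: mcosh.
apply: (le_trans (lee_wpmul2r _ IH)) => //.
by rewrite -EFinM -exprSr.
Qed.

Lemma gram_sum_tail n (r : R) : 0 < c -> 0 <= r -> (0 < n)%N ->
  (tuple_measure P n [set t : n.-tuple T | (r <= Num.sqrt (gram_sum t))%R] <=
   (2 * expR (- (r ^+ 2 / (2 * n%:R * c ^+ 2))))%:E)%E.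
Proof.
move=> c0 r0 n0; have nR0 : 0 < n%:R :> R by rewrite ltr0n.
(* Minimizes the Chernoff exponent [n lam^2 c^2 / 2 - lam r]. *)
pose lam := r / (n%:R * c ^+ 2).
have lam0 : 0 <= lam by rewrite divr_ge0// mulr_ge0// sqr_ge0.
set A := [set t : n.-tuple T | _].
have mA : measurable A.
  rewrite -[A]setTI; apply: measurable_fun_le => //.
  by apply: measurableT_comp; [exact: measurable_sqrtr|exact: measurable_gram_sum].
have hA : ((expR (lam * r) / 2)%:E * tuple_measure P n A <=
    (cosh (lam * c) ^+ n)%:E)%E.
  apply: le_trans (mgf_tuple n lam0).
  rewrite -integral_cst//.
  apply: (@le_trans _ _ (\int[tuple_measure P n]_(t in A)
      (cosh (lam * Num.sqrt (gram_sum t)))%:E)%E).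
    apply: ge0_le_integral => //.
    - by move=> t _; rewrite lee_fin divr_ge0// expR_ge0.
    - apply: (measurable_funS measurableT) => //; exact: measurable_cosh_gram.
    - move=> t /= rt; rewrite lee_fin; apply: le_trans (cosh_ge _).
      by rewrite ler_wpM2r// ler_expR ler_wpM2l.
  apply: ge0_subset_integral => //; first exact: measurable_cosh_gram.
  by move=> t _; rewrite lee_fin ltW// cosh_gt0.
have e0 : 0 < expR (lam * r) / 2 by rewrite divr_gt0 ?expR_gt0.
rewrite -(@lee_pmul2l _ (expR (lam * r) / 2)%:E)//.
apply: (le_trans hA); rewrite -EFinM lee_fin.
apply: (@le_trans _ _ (expR ((lam * c) ^+ 2 / 2) ^+ n)).
  by rewrite lerXn2r ?nnegrE ?expR_ge0 ?(ltW (cosh_gt0 _))// cosh_le_expR.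
rewrite -expRM_natl [leRHS]mulrA divfK ?pnatr_eq0// -expRD ler_expR /lam.
rewrite -subr_ge0 [X in 0 <= X](_ : _ = 0)//.
by field; rewrite !gt_eqF.
Qed.

End pinelis.

(** * Posterior concentration *)

Section weighted_integral.
Context {d : measure_display} {U : measurableType d} {R : realType}.
Variables (nu : {measure set U -> \bar R}) (p : U -> R).
Hypothesis mp : measurable_fun setT p.
Hypothesis p_ge0 : forall v, 0 <= p v.
Hypothesis p1 : (\int[nu]_v (p v)%:E = 1)%E.

Lemma integrable_weight (f : U -> R) : bdmeas f ->
  nu.-integrable setT (EFin \o (fun v => p v * f v)).
Proof.
move=> [mf [M fM]].
have ip : nu.-integrable setT (EFin \o p).
  apply/integrableP; split; first exact/measurable_EFinP.
  under eq_integral do rewrite /= ger0_norm//.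
  by rewrite p1 ltry.
have iMp : nu.-integrable setT (EFin \o (fun v => M * p v)).
  exact: integrableZl ip.
apply: le_integrable iMp => //.
  by apply/measurable_EFinP; exact: measurable_funM.
move=> v _; rewrite lee_fin normrM [leRHS]normrM [leRHS]mulrC.
by rewrite ler_wpM2l// (le_trans (fM v))// ler_norm.
Qed.

Lemma wintD (f g : U -> R) : bdmeas f -> bdmeas g ->
  \int[nu]_v (p v * (f v + g v)) = \int[nu]_v (p v * f v) + \int[nu]_v (p v * g v).
Proof.
move=> bf bg; under eq_Rintegral do rewrite mulrDr.
by rewrite RintegralD//; exact: integrable_weight.
Qed.

Lemma wintZ (c : R) (f : U -> R) : bdmeas f ->
  \int[nu]_v (p v * (c * f v)) = c * \int[nu]_v (p v * f v).
Proof.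
move=> bf; under eq_Rintegral do rewrite mulrCA.
by rewrite RintegralZl//; exact: integrable_weight.
Qed.

Lemma wint_cst (c : R) : \int[nu]_v (p v * c) = c.
Proof.
transitivity (\int[nu]_v (p v * (c * 1))).
  by apply: eq_Rintegral => v _; rewrite mulr1.
rewrite (@wintZ c (fun _ => 1)); last exact: bdmeas_cst.
rewrite [X in _ * X](_ : _ = 1) ?mulr1// /Rintegral.
by under eq_integral do rewrite mulr1; rewrite p1.
Qed.

Lemma le_wint (f g : U -> R) : bdmeas f -> bdmeas g -> (forall v, f v <= g v) ->
  \int[nu]_v (p v * f v) <= \int[nu]_v (p v * g v).
Proof.
move=> bf bg fg; apply: le_Rintegral => //; try exact: integrable_weight.
by move=> v _; rewrite ler_wpM2l.
Qed.

Lemma bdmeas_expR (f : U -> R) : bdmeas f -> bdmeas (fun v => expR (f v)).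
Proof.
move=> [mf [M fM]]; split; first by apply: measurableT_comp => //; exact: measurable_expR.
exists (expR M) => v; rewrite ger0_norm ?expR_ge0// ler_expR.
by apply: le_trans (fM v); exact: ler_norm.
Qed.

Lemma bdmeas_indic (B : set U) : measurable B -> bdmeas (\1_B : U -> R).
Proof.
move=> mB; split; first exact: measurable_indic.
by exists 1 => v; rewrite indicE; case: (_ \in _); rewrite ?normr1 ?normr0.
Qed.

Lemma wint_expR_gt0 (f : U -> R) : bdmeas f ->
  0 < \int[nu]_v (p v * expR (f v)).
Proof.
move=> bf; have [_ [M fM]] := bf.
apply: (@lt_le_trans _ _ (expR (- M))); first exact: expR_gt0.
rewrite -[leLHS]wint_cst; apply: le_wint; [exact: bdmeas_cst|exact: bdmeas_expR|].
by move=> v; rewrite ler_expR; have := fM v; rewrite ler_norml => /andP[].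
Qed.

(* Compare the loss [l] with the level [a], chosen so that the evidence is at
   least [exp (- w a)], and integrate [exp (- x) (1 + x) <= 1] at
   [x = w (l - a)]: no relative entropy is needed. *)
Lemma posterior_excess (l e : U -> R) (B : set U) (w n H c1 delta A : R) :
  bdmeas l -> bdmeas e -> measurable B -> 0 < w -> 0 < n ->
  (forall v, `|l v - n * e v - c1| <= H) ->
  (forall v, B v -> e v <= delta) ->
  expR (- A) <= \int[nu]_v (p v * \1_B v) ->
  \int[nu]_v (p v * (e v * expR (- (w * l v)))) <=
  (2 * H / n + delta + A / (w * n)) * \int[nu]_v (p v * expR (- (w * l v))).
Proof.
move=> bl be mB w0 n0 lH Bdelta massB.
set Z := \int[nu]_v (p v * expR (- (w * l v))).
pose a := c1 + H + n * delta + A / w.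
have bu : bdmeas (fun v => expR (- (w * l v))).
  by apply: bdmeas_expR; apply: bdmeasN; exact: bdmeasZ.
have Zge : expR (- (w * a)) <= Z.
  have -> : - (w * a) = - (w * (c1 + H + n * delta)) + (- A).
    by rewrite /a; field; rewrite gt_eqF.
  rewrite expRD.
  apply: (@le_trans _ _ (expR (- (w * (c1 + H + n * delta))) *
      \int[nu]_v (p v * \1_B v))).
    by rewrite ler_wpM2l ?expR_ge0.
  have bB := bdmeas_indic mB.
  rewrite -wintZ//; apply: le_wint => //; first exact: bdmeasZ.
  move=> v; rewrite indicE; case: (asboolP (B v)) => Bv; last first.
    by rewrite memNset// mulr0 expR_ge0.
  rewrite mem_set// mulr1 ler_expR lerN2 ler_wpM2l ?(ltW w0)//.
  have := lH v; rewrite ler_norml => /andP[_ ].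
  by have := ler_wpM2l (ltW n0) (Bdelta _ Bv); lra.
have pw v : w * n * (e v * expR (- (w * l v))) <=
    expR (- (w * a)) + (w * (2 * H + n * delta + A / w) - 1) * expR (- (w * l v)).
  have e1 : n * e v <= l v - a + (2 * H + n * delta + A / w).
    by have := lH v; rewrite ler_norml /a => /andP[+ _]; lra.
  have e2 : expR (- (w * l v)) * (1 + w * (l v - a)) <= expR (- (w * a)).
    rewrite (_ : - (w * a) = - (w * l v) + w * (l v - a)); last by ring.
    by rewrite [leRHS]expRD ler_wpM2l ?expR_ge0// expR_ge1Dx.
  have e3 := ler_wpM2l (mulr_ge0 (ltW w0) (expR_ge0 (- (w * l v)))) e1.
  by nra.
have : w * n * \int[nu]_v (p v * (e v * expR (- (w * l v)))) <=
    expR (- (w * a)) + (w * (2 * H + n * delta + A / w) - 1) * Z.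
  rewrite -wintZ; last exact: bdmeasM.
  rewrite -[X in _ <= X + _]wint_cst -wintZ// -wintD; last 2 first.
    exact: bdmeas_cst.
    exact: bdmeasZ.
  apply: le_wint => //.
    by apply: bdmeasZ; exact: bdmeasM.
  by apply: bdmeasD; [exact: bdmeas_cst|exact: bdmeasZ].
have wn0 : 0 < w * n by rewrite mulr_gt0.
move=> H1; rewrite -(ler_pM2l wn0); apply: (le_trans H1).
(* The multiples of [Z] on both sides differ by the [- 1] in [pw]; this spare [Z] pays for
   [expR (- (w * a))], by [Zge]. *)
rewrite -subr_ge0 [X in 0 <= X](_ : _ = Z - expR (- (w * a))) ?subr_ge0//.
by field; rewrite !gt_eqF.
Qed.

End weighted_integral.

Section fubini_bounded.
Context {d1 d2 : measure_display} {T1 : measurableType d1}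
  {T2 : measurableType d2} {R : realType}.
Variables (P : probability T1 R) (Q : probability T2 R) (f : T1 * T2 -> R).
Hypothesis bf : bdmeas f.

Lemma integrable_prod_bd : (P \x Q)%E.-integrable setT (EFin \o f).
Proof.
exact: (bdmeas_integrable (P \x Q)%E bf).
Qed.

Let bf1 x : bdmeas (fun y => f (x, y)).
Proof. exact: (bdmeas_comp bf (pair1_measurable x)). Qed.

Let bf2 y : bdmeas (fun x => f (x, y)).
Proof. exact: (bdmeas_comp bf (pair2_measurable y)). Qed.

Lemma Rintegral_prod12 :
  \int[(P \x Q)%E]_z f z = \int[P]_x \int[Q]_y f (x, y).
Proof.
rewrite /Rintegral -(integral12_prod_meas1 integrable_prod_bd); congr fine.
apply: eq_integral => x _; rewrite fineK//.
by apply: integrable_fin_num => //; exact: bdmeas_integrable.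
Qed.

Lemma Rintegral_prod21 :
  \int[(P \x Q)%E]_z f z = \int[Q]_y \int[P]_x f (x, y).
Proof.
rewrite /Rintegral -(integral21_prod_meas1 integrable_prod_bd); congr fine.
apply: eq_integral => y _; rewrite fineK//.
by apply: integrable_fin_num => //; exact: bdmeas_integrable.
Qed.

End fubini_bounded.

(** * Risk and empirical loss of a kernel score *)

Section score.
Context {d1 d2 : measure_display} {U : measurableType d1}
  {T : measurableType d2} {R : realType}.
Variables (nu : {sigma_finite_measure set U -> \bar R}) (p : U -> R).
Hypothesis mp : measurable_fun setT p.
Hypothesis p_ge0 : forall v, 0 <= p v.
Hypothesis p1 : (\int[nu]_v (p v)%:E = 1)%E.
Variables (P : U -> probability T R) (P0 : probability T R).
Hypothesis mP : forall A, measurable A -> measurable_fun setT (fun v => P v A).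
Variables (k : T -> T -> R) (K : U -> R).
Hypothesis bk : bdmeas (fun z : T * T => k z.1 z.2).
Hypothesis ksym : forall x y, k x y = k y x.
Hypothesis bK : bdmeas K.

Local Notation m0 := (mean_embedding P0 k).

(** The self-energy is an arbitrary bounded [K]: it does not depend on [y], so it cancels between
    loss and risk. *)
Definition score (v : U) (y : T) : R := K v - 2 * mean_embedding (P v) k y.

Definition risk (v : U) : R := \int[P0]_y score v y.

Definition sample_loss (s : seq T) (v : U) : R := \sum_(y <- s) score v y.

Lemma bdmeas_score : bdmeas (fun z : U * T => score z.1 z.2).
Proof.
apply: bdmeasB; first exact: (bdmeas_comp bK measurable_fst).
apply: bdmeasZ.
apply: (@bdmeas_kernel _ _ _ _ _ (fun z : U * T => P z.1) _
  (fun z => k z.2 z.1.2)).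
  by move=> A mA; exact: (measurableT_comp (mP mA) measurable_fst).
apply: (bdmeas_comp bk (f := fun z : (U * T) * T => (z.2, z.1.2))).
apply: measurable_fun_pair; first exact: measurable_snd.
exact: (measurableT_comp measurable_snd measurable_fst).
Qed.

Lemma bdmeas_score1 y : bdmeas (fun v => score v y).
Proof. exact: (bdmeas_comp bdmeas_score (pair2_measurable y)). Qed.

Lemma bdmeas_risk : bdmeas risk.
Proof.
by apply: (@bdmeas_kernel _ _ _ _ _ (fun _ : U => P0)
  (fun A mA => measurable_cst _) _ bdmeas_score).
Qed.

Lemma bdmeas_loss s : bdmeas (sample_loss s).
Proof. by apply: bdmeas_sum => y; exact: bdmeas_score1. Qed.

Lemma riskE v : risk v = K v - 2 * \int[P v]_x m0 x.
Proof.
have bm := bdmeas_mean_embedding (P v) bk ksym.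
rewrite /risk RintegralB_bd; [|exact: bdmeas_cst|exact: bdmeasZ].
rewrite Rintegral_cst_bd RintegralZ_bd//; congr (_ - _ * _).
rewrite -(Rintegral_prod21 (P v) P0 bk) Rintegral_prod12//.
by apply: eq_Rintegral => x _; apply: eq_Rintegral => y _ /=; rewrite ksym.
Qed.

(** The deviation is [- 2] times an average over [P v] of the quantity bounded in the hypothesis.
    Neither [g] nor [G] depends on [v], whence uniformity over the model. *)
Lemma loss_deviation s v (g G : R) :
  (forall x, `|\sum_(y <- s) (k x y - m0 x) - g| <= G) ->
  `|sample_loss s v - (size s)%:R * risk v - (- (2 * g))| <= 2 * G.
Proof.
move=> hG.
have bm0 := bdmeas_mean_embedding P0 bk ksym.
have bd y : bdmeas (fun x => k x y - m0 x).
  by apply: bdmeasB => //; exact: bdmeas_section.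
have -> : sample_loss s v - (size s)%:R * risk v - (- (2 * g)) =
    - 2 * \int[P v]_x (\sum_(y <- s) (k x y - m0 x) - g).
  rewrite RintegralB_bd; [|exact: bdmeas_sum|exact: bdmeas_cst].
  rewrite Rintegral_cst_bd Rintegral_sum_bd// riskE /sample_loss /score.
  under [in RHS]eq_bigr => y _ do
    rewrite (RintegralB_bd _ (bdmeas_section bk y) bm0).
  have cs (c : R) : \sum_(y <- s) c = (size s)%:R * c.
    by rewrite big_const_seq count_predT iter_addr_0 mulr_natl.
  rewrite !sumrB -mulr_sumr !cs /mean_embedding; ring.
rewrite normrM normrN (ger0_norm (ler0n R 2)) ler_wpM2l//.
by apply: le_Rintegral_norm => //; apply: bdmeasB; [exact: bdmeas_sum|exact: bdmeas_cst].
Qed.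

End score.

Lemma measurable_Rintegral_ge0 {d1 d2 : measure_display} {S : measurableType d1}
    {U : measurableType d2} {R : realType}
    (nu : {sigma_finite_measure set U -> \bar R}) (f : S * U -> R) :
  measurable_fun setT f -> (forall z, 0 <= f z) ->
  measurable_fun setT (fun s => \int[nu]_v f (s, v)).
Proof.
move=> mf f0; apply: measurableT_comp => //.
apply: (measurable_fun_fubini_tonelli_F (m2 := nu) (EFin \o f)) => //.
exact/measurable_EFinP.
Qed.

Section posterior_tail.
Context {d1 d2 : measure_display} {U : measurableType d1}
  {T : measurableType d2} {R : realType}.
Variables (nu : {sigma_finite_measure set U -> \bar R}) (p : U -> R).
Hypothesis mp : measurable_fun setT p.
Hypothesis p_ge0 : forall v, 0 <= p v.
Hypothesis p1 : (\int[nu]_v (p v)%:E = 1)%E.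
Variables (P : U -> probability T R) (P0 : probability T R).
Hypothesis mP : forall A, measurable A -> measurable_fun setT (fun v => P v A).
Variables (k : T -> T -> R) (K : U -> R).
Hypothesis bk : bdmeas (fun z : T * T => k z.1 z.2).
Hypothesis ksym : forall x y, k x y = k y x.
Hypothesis bK : bdmeas K.
Variables (X : set T) (w eps rmin : R) (n : nat).
Hypothesis mX : measurable X.
Hypothesis rmin_le : forall v, rmin <= risk P P0 k K v.

Local Notation loss := (sample_loss P k K).
Local Notation excess := (fun v => risk P P0 k K v - rmin).

Definition posterior_mean_excess (s : seq T) : R :=
  \int[nu]_v (p v * (excess v * expR (- (w * loss s v)))) /
  \int[nu]_v (p v * expR (- (w * loss s v))).

Definition excess_event : set (n.-tuple T) :=
  [set t : n.-tuple T | (forall i, X (tnth t i)) /\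
             eps <= `|posterior_mean_excess t| ].

Let be : bdmeas excess.
Proof.
apply: bdmeasB; last exact: bdmeas_cst.
exact: (bdmeas_risk P0 mP bk bK).
Qed.

Lemma measurable_excess_event : measurable excess_event.
Proof.
have ml : measurable_fun setT (fun z : n.-tuple T * U => expR (- (w * loss z.1 z.2))).
  apply: measurableT_comp; first exact: measurable_expR.
  apply: measurableT_comp => //.
  apply: measurable_funM; first exact: measurable_cst.
  rewrite /sample_loss; under eq_fun do rewrite big_tuple.
  apply: measurable_sum => i.
  have mi : measurable_fun setT (fun z : n.-tuple T * U => (z.2, tnth z.1 i)).
    apply: measurable_fun_pair; first exact: measurable_snd.
    by apply: (measurableT_comp (measurable_tnth i)); exact: measurable_fst.
  by case: (bdmeas_comp (bdmeas_score mP bk bK) mi).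
have mp2 : measurable_fun setT (fun z : n.-tuple T * U => p z.2).
  exact: (measurableT_comp mp measurable_snd).
have mpost : measurable_fun setT (fun t : n.-tuple T => posterior_mean_excess t).
  apply: measurable_funM.
    apply: (measurable_Rintegral_ge0 nu (f := fun z : n.-tuple T * U =>
      p z.2 * (excess z.2 * expR (- (w * loss z.1 z.2))))).
      apply: measurable_funM => //; apply: measurable_funM => //.
      exact: (measurableT_comp be.1 measurable_snd).
    by move=> z; rewrite !mulr_ge0// ?expR_ge0// subr_ge0.
  under eq_fun => t.
    (* The evidence is nonnegative, so its inverse is the real power -1, which is known to be
       measurable. *)
    rewrite -powR_inv1; last first.
      by apply: Rintegral_ge0 => v _; rewrite mulr_ge0// expR_ge0.
    over.
  apply: (measurableT_comp (measurable_powR (- 1))).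
  apply: (measurable_Rintegral_ge0 nu (f := fun z : n.-tuple T * U =>
    p z.2 * expR (- (w * loss z.1 z.2)))).
    exact: measurable_funM.
  by move=> z; rewrite mulr_ge0// expR_ge0.
have -> : excess_event =
    (\bigcap_(i in [set: 'I_n]) ((@tnth _ _ ^~ i) @^-1` X)) `&`
    [set t : n.-tuple T | eps <= `|posterior_mean_excess t|].
  apply/seteqP; split => t /= [h1 h2]; split => // i; first by move=> _; exact: h1.
  exact: h1.
apply: measurableI.
  apply: fin_bigcap_measurable => // i _.
  by rewrite -[X in measurable X]setTI; exact: measurable_tnth.
rewrite -[X in measurable X]setTI; apply: measurable_fun_le => //.
by apply: measurableT_comp.
Qed.

Lemma excess_event_le1 : (tuple_measure P0 n excess_event <= 1)%E.
Proof.
rewrite -(tuple_measure_setT P0 n); apply: le_measure; rewrite ?inE//.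
exact: measurable_excess_event.
Qed.

Variables (b c a1 a2 : R) (g : seq T -> R).
Hypothesis w0 : 0 < w.
Hypothesis n0 : (0 < n)%N.
Hypothesis b0 : 0 < b.
Hypothesis c0 : 0 < c.
Hypothesis kcpsd : psd_mass [set 0] k.
Hypothesis kc : forall x, centered P0 k x x <= c ^+ 2.
Hypothesis kb : forall x s,
  `|\sum_(y <- s) (k x y - mean_embedding P0 k x) - g s| <=
  b * Num.sqrt (gram_sum (centered P0 k) s).
Hypothesis prior_mass : expR (- (a2 * Num.sqrt n%:R)) <=
  \int[nu]_v (p v * \1_[set v | excess v <= a1 / Num.sqrt n%:R] v).

(** [b], [c] and [g] stay free to serve both scores: [g] is 0 for the kernel score, and a sum of
    centered mean embeddings over the sample for the energy score. *)
Lemma excess_event_tail : a1 + a2 / w <= Num.sqrt n%:R * eps ->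
  (tuple_measure P0 n excess_event <=
   (2 * expR (- (1 / 2 * ((Num.sqrt n%:R * eps - a1 - a2 / w) /
                          (4 * b * c)) ^+ 2)))%:E)%E.
Proof.
move=> t_ge0; set t := Num.sqrt n%:R * eps - a1 - a2 / w.
have t0 : 0 <= t by rewrite /t; lra.
pose rn : R := Num.sqrt n%:R.
have rn0 : 0 < rn by rewrite sqrtr_gt0 ltr0n.
have rn2 : rn ^+ 2 = n%:R by rewrite sqr_sqrtr.
have nR0 : 0 < n%:R :> R by rewrite ltr0n.
(* Solves [sqrt n * eps = a1 + a2 / w + 4 b r / sqrt n] for [r]. The threshold hypothesis gives
   [0 <= r], which the tail inequality needs. *)
pose r := t * rn / (4 * b).
have r0 : 0 <= r by rewrite divr_ge0// mulr_ge0// ltW.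
have b4 : 0 < 4 * b by rewrite mulr_gt0.
pose G := centered P0 k.
have mG : measurable_fun setT (fun s : n.-tuple T => gram_sum G s).
  by apply: measurable_gram_sum; exact: bdmeas_centered.
apply: (@le_trans _ _ (tuple_measure P0 n
    [set s : n.-tuple T | r <= Num.sqrt (gram_sum G s)])).
  apply: le_measure; rewrite ?inE; first exact: measurable_excess_event.
    rewrite -[X in measurable X]setTI; apply: measurable_fun_le => //.
    by apply: measurableT_comp; first exact: measurable_sqrtr.
  move=> s /= [_].
  set q := Num.sqrt (gram_sum G s).
  have bl : bdmeas (loss s) by exact: bdmeas_loss.
  have Z0 : 0 < \int[nu]_v (p v * expR (- (w * loss s v))).
    by apply: wint_expR_gt0 => //; apply: bdmeasN; exact: bdmeasZ.
  have N0 : 0 <= \int[nu]_v (p v * (excess v * expR (- (w * loss s v)))).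
    by apply: Rintegral_ge0 => v _; rewrite !mulr_ge0 ?expR_ge0// subr_ge0.
  rewrite ger0_norm; last by rewrite divr_ge0// ltW.
  (* Passing from risk to excess only enlarges the shift by [n rmin], which is again free of [v]. *)
  have dev v : `|loss s v - n%:R * excess v - (n%:R * rmin - 2 * g s)| <=
      2 * (b * q).
    have := loss_deviation P K bk ksym v (fun x => kb x s).
    rewrite size_tuple; congr (`|_| <= _); ring.
  have mB : measurable [set v | excess v <= a1 / rn].
    rewrite -[X in measurable X]setTI; apply: measurable_fun_le => //.
    exact: be.1.
  have := posterior_excess mp p_ge0 p1 bl be mB w0 nR0 dev (fun v Bv => Bv)
    prior_mass.
  rewrite -ler_pdivrMr// => h /le_trans /(_ h) epsle.
  rewrite /r ler_pdivrMr//.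
  have : n%:R * eps <= 4 * b * q + rn * a1 + a2 * rn / w.
    have -> : 4 * b * q + rn * a1 + a2 * rn / w = n%:R *
        (2 * (2 * (b * q)) / n%:R + a1 / rn + a2 * rn / (w * n%:R)).
      by rewrite -rn2; field; rewrite !gt_eqF.
    by rewrite ler_wpM2l// ltW.
  rewrite /t -/rn -rn2 => h2.
  rewrite (_ : (rn * eps - a1 - a2 / w) * rn =
    rn ^+ 2 * eps - rn * a1 - a2 * rn / w); last by ring.
  by lra.
have := gram_sum_tail (bdmeas_centered P0 bk ksym) (centered_sym P0 ksym)
  (psd_centered P0 bk ksym kcpsd) (centered_mean P0 bk ksym) (ltW c0) kc c0 r0 n0.
move=> /le_trans; apply; rewrite lee_fin ler_wpM2l// ler_expR lerN2.
rewrite /r -rn2 le_eqVlt; apply/orP; left; apply/eqP.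
by field; rewrite !gt_eqF.
Qed.

End posterior_tail.

(** * Restriction to the data and parameter spaces *)

Lemma measurable_if_mem {d1 d2 : measure_display} {T1 : measurableType d1}
    {T2 : measurableType d2} (D : set T1) (f h : T1 -> T2) : measurable D ->
  measurable_fun D f -> measurable_fun setT h ->
  measurable_fun setT (fun t => if t \in D then f t else h t).
Proof.
move=> mD mf mh.
have DE : (fun t : T1 => t \in D) @^-1` [set true] = D.
  by apply/seteqP; split => t /=; [exact: set_mem|exact: mem_set].
apply: measurable_fun_if => //.
- by apply: (measurable_fun_bool true); rewrite setTI DE.
- by rewrite setTI DE.
- exact: (measurable_funS measurableT).
Qed.

Section full_measure.
Context {d : measure_display} {T : measurableType d} {R : realType}.
Variables (Q : probability T R) (X : set T).
Hypothesis mX : measurable X.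
Hypothesis QX : Q X = 1%E.

Lemma Rintegral_full_measure (f f1 : T -> R) : bdmeas f1 ->
  (forall x, X x -> f x = f1 x) -> \int[Q]_(x in X) f x = \int[Q]_x f1 x.
Proof.
move=> bf ff1; rewrite /Rintegral.
rewrite (@negligible_integral _ _ _ Q setT (~` X)) //.
- rewrite setTD setCK; congr fine; apply: eq_integral => x.
  by rewrite inE => /ff1 ->.
- exact: measurableC.
- exact: bdmeas_integrable.
- suff : Q (~` X) = 0%E by [].
  by rewrite probability_setC// QX subee.
Qed.

Lemma full_measure_prod : (Q \x Q)%E (X `*` X) = 1%E.
Proof.
transitivity (Q X * Q X)%E; first exact: product_measure1E.
by rewrite QX mule1.
Qed.

End full_measure.

Section retract.
Context {d : measure_display} {T : measurableType d} {R : realType}.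
Variables (X : set T) (x0 : T).
Hypothesis mX : measurable X.
Hypothesis Xx0 : X x0.

(** Composing a kernel with this map extends it from [X * X] to the whole space, keeping its bounds,
    symmetry and positivity. *)
Definition retract (x : T) : T := if x \in X then x else x0.

Lemma retract_mem x : X (retract x).
Proof. by rewrite /retract; case: ifPn => //; rewrite inE. Qed.

Lemma retract_id x : X x -> retract x = x.
Proof. by move=> Xx; rewrite /retract mem_set. Qed.

Lemma measurable_retract : measurable_fun setT retract.
Proof.
apply: measurable_if_mem => //; exact: measurable_cst.
Qed.

Lemma bdmeas_retract (k : T -> T -> R) (M : R) :
  measurable_fun (X `*` X) (fun z : T * T => k z.1 z.2) ->
  (forall x y, X x -> X y -> `|k x y| <= M) ->
  bdmeas (fun z : T * T => k (retract z.1) (retract z.2)).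
Proof.
move=> mk kM; split; last first.
  by exists M => z; apply: kM; exact: retract_mem.
apply: (measurable_comp (F := X `*` X) (f := fun z : T * T => k z.1 z.2)
  (g := fun z : T * T => (retract z.1, retract z.2))) => //.
- exact: measurableX.
- by move=> _ [z _ <-]; split; exact: retract_mem.
- by apply: measurable_fun_pair; apply: (measurableT_comp measurable_retract).
Qed.

End retract.

Section score_posterior_tail.
Context {R : realType} {d p : nat}.
Local Notation E := (d.-tuple R).
Variables (X : set E) (Theta : set (p.-tuple R))
  (P : p.-tuple R -> probability E R) (P0 : probability E R)
  (prior : p.-tuple R -> R) (w : R).
Hypotheses (mX : measurable X) (mTheta : measurable Theta).
Hypothesis PX : statistical_model Theta P X.
Hypothesis P0X : P0 X = 1%E.
Hypothesis prior_dens : prob_density Theta prior.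
Hypothesis w_gt0 : 0 < w.
Variables (x0 : E) (thetastar : p.-tuple R) (k : E -> E -> R) (M : R)
  (S : probability E R -> E -> R).
Hypothesis Xx0 : X x0.
Hypothesis mk : measurable_fun (X `*` X) (fun z : E * E => k z.1 z.2).
Hypothesis ksym : forall x y, X x -> X y -> k x y = k y x.
Hypothesis kM : forall x y, X x -> X y -> `|k x y| <= M.
Hypothesis SE : forall (Q : probability E R) y, Q X = 1%E -> X y -> S Q y = kernel_score X k Q y.
Hypothesis star : is_argmin Theta P (divergence X S) P0 thetastar.

Definition global_kernel (x y : E) : R := k (retract X x0 x) (retract X x0 y).
Local Notation k1 := global_kernel.

(** With [P thetastar] outside [Theta], the model is measurable in [v] and [risk_min] holds for
    every [v]; the extended prior vanishes there. *)
Definition global_model (v : p.-tuple R) : probability E R :=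
  if v \in Theta then P v else P thetastar.
Local Notation P1 := global_model.

Definition global_prior : p.-tuple R -> R := prior \_ Theta.
Local Notation p1 := global_prior.

Definition self_energy (v : p.-tuple R) : R := \int[P1 v]_x \int[P1 v]_y k1 x y.
Local Notation K := self_energy.

Lemma bdmeas_global_kernel : bdmeas (fun z : E * E => k1 z.1 z.2).
Proof. exact: bdmeas_retract mk kM. Qed.

Lemma global_kernel_sym x y : k1 x y = k1 y x.
Proof. by apply: ksym; exact: retract_mem. Qed.

Lemma global_modelX v : P1 v X = 1%E.
Proof.
rewrite /P1; case: ifPn => [|_]; first by rewrite inE => /PX.1.
by apply: PX.1; case: star.
Qed.

Lemma measurable_global_model A : measurable A ->
  measurable_fun setT (fun v => P1 v A).
Proof.
move=> mA; rewrite (_ : (fun v => _) =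
  (fun v => if v \in Theta then P v A else P thetastar A)); last first.
  by apply/funext => v; rewrite /P1; case: ifP.
by apply: measurable_if_mem => //; exact: PX.2.
Qed.

Lemma bdmeas_self_energy : bdmeas K.
Proof.
have mP1 : forall A, measurable A ->
    measurable_fun setT (fun z : p.-tuple R * E => P1 z.1 A).
  by move=> A mA; exact: (measurableT_comp (measurable_global_model mA) measurable_fst).
have b2 : bdmeas (fun z : p.-tuple R * E => \int[P1 z.1]_y k1 z.2 y).
  apply: (@bdmeas_kernel _ _ _ _ _ (fun z : p.-tuple R * E => P1 z.1) mP1
    (fun z => k1 z.1.2 z.2)).
  apply: (bdmeas_comp bdmeas_global_kernel
    (f := fun z : (p.-tuple R * E) * E => (z.1.2, z.2))).
  apply: measurable_fun_pair; last exact: measurable_snd.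
  exact: (measurableT_comp measurable_snd measurable_fst).
exact: (@bdmeas_kernel _ _ _ _ _ P1 measurable_global_model _ b2).
Qed.

Lemma score_global v y : X y -> S (P1 v) y = score P1 k1 K v y.
Proof.
move=> Xy; have bk := bdmeas_global_kernel.
have retr x : X x -> retract X x0 x = x by exact: retract_id.
rewrite SE ?global_modelX// /kernel_score /score; congr (_ - _ * _).
  rewrite /K -(Rintegral_prod12 (P1 v) (P1 v) bk).
  apply: Rintegral_full_measure => //; first exact: measurableX.
    exact: full_measure_prod mX (global_modelX v).
  by move=> [x x'] [/= Xx Xx']; rewrite /k1 !retr.
apply: Rintegral_full_measure => //; first exact: global_modelX.
  exact: bdmeas_section.
by move=> x Xx; rewrite /k1 !retr.
Qed.

Lemma global_model_id v : Theta v -> P1 v = P v.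
Proof. by move=> Tv; rewrite /P1 mem_set. Qed.

Lemma divergence_global v : Theta v -> divergence X S (P v) P0 =
  risk P1 P0 k1 K v - expected_score X S P0 P0.
Proof.
move=> Tv; rewrite /divergence; congr (_ - _); rewrite -global_model_id//.
rewrite /expected_score; apply: Rintegral_full_measure => //.
  have bs := bdmeas_score measurable_global_model bdmeas_global_kernel bdmeas_self_energy.
  exact: (bdmeas_comp bs (pair1_measurable v)).
by move=> y Xy; exact: score_global.
Qed.

Let C := expected_score X S P0 P0.
Let rmin := risk P1 P0 k1 K thetastar.

Lemma risk_min v : rmin <= risk P1 P0 k1 K v.
Proof.
have [Ts hs] := star; rewrite /rmin.
have [Tv|nTv] := boolP (v \in Theta).
  by have := hs _ (set_mem Tv); rewrite !divergence_global//; [lra|exact: set_mem].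
suff -> : risk P1 P0 k1 K v = risk P1 P0 k1 K thetastar by [].
by rewrite /risk /score /K /P1 (negbTE nTv) (mem_set Ts).
Qed.

Lemma measurable_global_prior : measurable_fun setT p1.
Proof. by apply/(measurable_restrictT prior mTheta); case: prior_dens. Qed.

Lemma global_prior_ge0 v : 0 <= p1 v.
Proof.
rewrite /p1 patchE; case: ifPn => // /set_mem Tv.
by case: prior_dens => _ + _; exact.
Qed.

Lemma global_prior_int : (\int[lebesgue_tuple p]_v (p1 v)%:E = 1)%E.
Proof.
case: prior_dens => _ _ <-; rewrite [RHS]integral_mkcond.
by apply: eq_integral => v _; rewrite /p1 restrict_EFin.
Qed.

Lemma likelihood_global n (Y : n.-tuple E) v : (forall i, X (tnth Y i)) ->
  Theta v -> score_likelihood P S w Y v = expR (- (w * sample_loss P1 k1 K Y v)).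
Proof.
move=> XY Tv; rewrite /score_likelihood /sample_loss big_tuple.
congr (expR (- (_ * _))); apply: eq_bigr => i _.
by rewrite -score_global// global_model_id.
Qed.

Lemma Rintegral_prior (f : p.-tuple R -> R) :
  \int[lebesgue_tuple p]_(v in Theta) (prior v * f v) =
  \int[lebesgue_tuple p]_v (p1 v * f v).
Proof.
rewrite Rintegral_mkcond; apply: eq_Rintegral => v _.
by rewrite /p1 !patchE; case: ifP => // _; rewrite mul0r.
Qed.

(** The divergence is the excess risk plus the constant [rmin - C]. The posterior has mass 1, so the
    constant cancels with the divergence at [thetastar]. *)
Lemma posterior_mean_global n (Y : n.-tuple E) : (forall i, X (tnth Y i)) ->
  \int[lebesgue_tuple p]_(v in Theta)
    (divergence X S (P v) P0 * score_posterior Theta P S w prior Y v)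
  - divergence X S (P thetastar) P0 =
  posterior_mean_excess (lebesgue_tuple p) p1 P1 P0 k1 K w rmin Y.
Proof.
move=> XY; have [Ts _] := star.
have mp1 := measurable_global_prior; have p10 := global_prior_ge0.
have i1 := global_prior_int.
have br := bdmeas_risk P0 measurable_global_model bdmeas_global_kernel
  bdmeas_self_energy.
have bl := bdmeas_loss measurable_global_model bdmeas_global_kernel
  bdmeas_self_energy Y.
pose e v := expR (- (w * sample_loss P1 k1 K Y v)).
have bE : bdmeas e by apply: bdmeas_expR; apply: bdmeasN; exact: bdmeasZ.
pose Z := \int[lebesgue_tuple p]_v (p1 v * e v).
have Z0 : Z != 0.
  rewrite gt_eqF// /Z; apply: (wint_expR_gt0 mp1 p10 i1).
  by apply: bdmeasN; exact: bdmeasZ.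
have ZE : \int[lebesgue_tuple p]_(t in Theta)
    (prior t * score_likelihood P S w Y t) = Z.
  rewrite /Z -Rintegral_prior; apply: eq_Rintegral => v /set_mem Tv.
  by rewrite likelihood_global.
rewrite divergence_global// -/rmin -/C.
have -> : \int[lebesgue_tuple p]_(v in Theta)
    (divergence X S (P v) P0 * score_posterior Theta P S w prior Y v) =
  \int[lebesgue_tuple p]_v (p1 v * (Z^-1 *
    ((risk P1 P0 k1 K v - rmin) * e v + (rmin - C) * e v))).
  rewrite -Rintegral_prior; apply: eq_Rintegral => v /set_mem Tv.
  by rewrite /score_posterior ZE divergence_global// likelihood_global// -/C -/(e v); ring.
have bex : bdmeas (fun v => (risk P1 P0 k1 K v - rmin) * e v).
  by apply: bdmeasM => //; apply: bdmeasB => //; exact: bdmeas_cst.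
rewrite (wintZ mp1 p10 i1); last by apply: bdmeasD => //; exact: bdmeasZ.
rewrite (wintD mp1 p10 i1)//; last exact: bdmeasZ.
rewrite (wintZ mp1 p10 i1)// -/Z /posterior_mean_excess -/Z.
by field.
Qed.

Lemma deviation_eventE n (eps : R) :
  deviation_event Theta P X S w prior P0 thetastar eps =
  excess_event (lebesgue_tuple p) p1 P1 P0 k1 K X w eps rmin (n := n).
Proof.
apply/seteqP; split => Y [XY hY]; split => //; move: hY.
  by rewrite (posterior_mean_global XY).
by rewrite -(posterior_mean_global XY).
Qed.

Lemma deviation_event_le1 n (eps : R) :
  (tuple_measure P0 n
    (deviation_event Theta P X S w prior P0 thetastar eps) <= 1)%E.
Proof.
rewrite deviation_eventE; apply: excess_event_le1 => //.
- exact: measurable_global_prior.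
- exact: global_prior_ge0.
- exact: measurable_global_model.
- exact: bdmeas_global_kernel.
- exact: bdmeas_self_energy.
- exact: risk_min.
Qed.

Variables (b c a1 a2 : R) (g : seq E -> R).
Hypothesis b0 : 0 < b.
Hypothesis c0 : 0 < c.
Hypothesis kcpsd : psd_mass [set 0] k1.
Hypothesis kc : forall x, centered P0 k1 x x <= c ^+ 2.
Hypothesis kb : forall x s,
  `|\sum_(y <- s) (k1 x y - mean_embedding P0 k1 x) - g s| <=
  b * Num.sqrt (gram_sum (centered P0 k1) s).
Hypothesis prior_mass :
  prior_mass_condition Theta P (divergence X S) P0 thetastar prior a1 a2.

Lemma deviation_event_tail n (eps : R) : (0 < n)%N ->
  a1 + a2 / w <= Num.sqrt n%:R * eps ->
  (tuple_measure P0 n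
    (deviation_event Theta P X S w prior P0 thetastar eps) <=
   (2 * expR (- (1 / 2 * ((Num.sqrt n%:R * eps - a1 - a2 / w) /
                          (4 * b * c)) ^+ 2)))%:E)%E.
Proof.
move=> n0 hn; rewrite deviation_eventE.
have mp1 := measurable_global_prior; have p10 := global_prior_ge0.
have i1 := global_prior_int.
have br := bdmeas_risk P0 measurable_global_model bdmeas_global_kernel
  bdmeas_self_energy.
apply: excess_event_tail => //; try exact: kb.
- exact: measurable_global_model.
- exact: bdmeas_global_kernel.
- exact: global_kernel_sym.
- exact: bdmeas_self_energy.
- exact: risk_min.
set B := [set v | _].
have mB : measurable B.
  rewrite -[X in measurable X]setTI; apply: measurable_fun_le => //.
  by case: (bdmeasB br (bdmeas_cst rmin)).
have iB := integrable_weight mp1 p10 i1 (bdmeas_indic mB).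
rewrite -lee_fin /Rintegral fineK; last exact: integrable_fin_num iB.
apply: le_trans (prior_mass n0) _.
rewrite le_eqVlt; apply/orP; left; apply/eqP.
rewrite [LHS]integral_mkcond; congr (integral _ _ _); apply/funext => v.
rewrite patchE /p1 patchE indicE.
have [Ts _] := star.
(* [B] may contain points outside [Theta], but [p1] vanishes there. Inside, minimality of
   [thetastar] removes the absolute value in [near_optimal]. *)
have [/set_mem Tv|nTv] := boolP (v \in Theta); last first.
  rewrite mul0r memNset// => -[Tv _].
  by move: nTv; rewrite (mem_set Tv).
have dE : `|divergence X S (P v) P0 - divergence X S (P thetastar) P0| =
    risk P1 P0 k1 K v - rmin.
  rewrite !divergence_global// -/rmin ger0_norm; first by ring.
  by have := risk_min v; lra.
have -> : (v \in near_optimal Theta P (divergence X S) P0 thetastar a1 n) = (v \in B).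
  apply/idP/idP => [/set_mem[_ h]|/set_mem h]; apply/mem_set.
    by rewrite /B/= -dE.
  by split => //; rewrite dE.
by case: ifP => _; rewrite ?mulr1 ?mulr0.
Qed.

End score_posterior_tail.

(** * Constants for the kernel score and the energy score *)

Lemma full_measure_nonempty {d : measure_display} {T : measurableType d}
    {R : realType} (Q : probability T R) (X : set T) : Q X = 1%E -> exists x, X x.
Proof.
move=> QX; apply: contrapT => /forallNP nX.
have X0 : X = set0 by apply/seteqP; split => // x /nX.
by move: QX; rewrite X0 measure0 => /eqP; rewrite eq_sym onee_eq0.
Qed.

Section centered_bounds.
Context {d : measure_display} {T : measurableType d} {R : realType}.
Variables (P0 : probability T R) (k : T -> T -> R).
Hypothesis bk : bdmeas (fun z : T * T => k z.1 z.2).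
Hypothesis ksym : forall x y, k x y = k y x.

Lemma centered_diag_le (M : R) x : (forall x y, `|k x y| <= M) ->
  centered P0 k x x <= 4 * M.
Proof.
move=> kM; have bm := bdmeas_mean_embedding P0 bk ksym.
have m0M y : `|mean_embedding P0 k y| <= M.
  by apply: le_Rintegral_norm => //; exact: bdmeas_section.
have K0M : `|mean_energy P0 k| <= M by exact: le_Rintegral_norm.
have := kM x x; have := m0M x; move: K0M; rewrite /centered !ler_norml.
by move=> /andP[_ ?] /andP[? _] /andP[_ ?]; lra.
Qed.

(** In [k x x - 2 m(x) + K0] only the middle term can be positive; the sign of the kernel thus
    halves the bound [4 M] of [centered_diag_le]. *)
Lemma centered_diag_le_npos (M : R) x :
  (forall x y, - M <= k x y <= 0) -> centered P0 k x x <= 2 * M.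
Proof.
move=> kM; have bm := bdmeas_mean_embedding P0 bk ksym.
have m0M y : - M <= mean_embedding P0 k y <= 0.
  apply/andP; split.
    rewrite -[leLHS](Rintegral_cst_bd P0); apply: le_Rintegral_bd.
    - exact: bdmeas_cst.
    - exact: bdmeas_section.
    - by move=> z; case/andP: (kM z y).
  rewrite -[leRHS](Rintegral_cst_bd P0); apply: le_Rintegral_bd.
  - exact: bdmeas_section.
  - exact: bdmeas_cst.
  - by move=> z; case/andP: (kM z y).
have K0M : mean_energy P0 k <= 0.
  rewrite -[leRHS](Rintegral_cst_bd P0 0); apply: le_Rintegral_bd => //.
    exact: bdmeas_cst.
  by move=> z; case/andP: (m0M z).
case/andP: (m0M x) => ? ?; case/andP: (kM x x) => ? ?; rewrite /centered; lra.
Qed.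

Lemma embedding_deviation_pd (kappa : R) x s : psd_mass setT k ->
  (forall x, k x x <= kappa) ->
  `|\sum_(y <- s) (k x y - mean_embedding P0 k x) - 0| <=
  Num.sqrt kappa * Num.sqrt (gram_sum (centered P0 k) s).
Proof.
move=> kp kk; rewrite subr0.
have kappa0 : 0 <= kappa.
  apply: le_trans (kk x); have := kp [:: (1, x)] Logic.I.
  by rewrite /qform !big_seq1/= !mul1r.
have := kernel_CauchySchwarz P0 bk ksym x [seq (1, y) | y <- s] kp.
rewrite big_map; under eq_bigr do rewrite mul1r.
rewrite -/(gram_sum (centered P0 k) s) => h.
have kp0 : psd_mass [set 0] k by move=> t _; exact: kp.
have g0 : 0 <= gram_sum (centered P0 k) s.
  exact: gram_sum_ge0 (psd_centered P0 bk ksym kp0) s.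
rewrite -sqrtrM// -sqrtr_sqr ler_wsqrtr// (le_trans h)//.
by rewrite ler_wpM2r.
Qed.

(** The subtracted sum completes each term to [centered P0 k x y], so that [row_sum_le] applies. *)
Lemma embedding_deviation_cpd (c : R) x s : psd_mass [set 0] k -> 0 <= c ->
  (forall x, centered P0 k x x <= c ^+ 2) ->
  `|\sum_(y <- s) (k x y - mean_embedding P0 k x) -
    \sum_(y <- s) (mean_embedding P0 k y - mean_energy P0 k)| <=
  c * Num.sqrt (gram_sum (centered P0 k) s).
Proof.
move=> kp c0 kc; rewrite -sumrB [leRHS]mulrC.
rewrite [X in `|X|](_ : _ = \sum_(y <- s) centered P0 k x y); last first.
  by apply: eq_bigr => y _; rewrite /centered; ring.
by apply: row_sum_le => //; [exact: centered_sym|exact: psd_centered].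
Qed.

End centered_bounds.

Section pd_kernel_global.
Context {R : realType} {d : nat}.
Local Notation E := (d.-tuple R).
Variables (X : set E) (k : E -> E -> R) (kappa : R) (x0 : E).
Hypothesis kpd : pd_kernel X k.
Hypothesis kk : forall x, X x -> k x x <= kappa.
Hypothesis Xx0 : X x0.

Lemma psd_pd_kernel :
  psd_mass setT (fun x y => k (retract X x0 x) (retract X x0 y)).
Proof.
move=> s _; have [_ _ kp] := kpd.
have := kp (size s) (fun i => (tnth (in_tuple s) i).1)
  (fun i => retract X x0 (tnth (in_tuple s) i).2) (fun i => retract_mem Xx0 _).
congr (_ <= _); rewrite /qform [RHS]big_tnth; apply: eq_bigr => i _.
by rewrite [RHS]big_tnth.
Qed.

(** Cauchy-Schwarz for two atoms: the diagonal controls the whole kernel. *)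
Lemma pd_kernel_bounded x y : X x -> X y -> `|k x y| <= kappa.
Proof.
move=> Xx Xy; have [_ ks _] := kpd.
have sym u v : k (retract X x0 u) (retract X x0 v) =
    k (retract X x0 v) (retract X x0 u) by apply: ks; exact: retract_mem.
have k0 z : X z -> 0 <= k z z.
  move=> Xz; have := psd_pd_kernel (s := [:: (1, z)]) Logic.I.
  by rewrite /qform !big_seq1/= !mul1r !retract_id.
have kappa0 : 0 <= kappa by exact: le_trans (k0 _ Xx) (kk Xx).
have := psd_mass_CauchySchwarz sym x [:: (1, y)] psd_pd_kernel.
rewrite /qform !big_seq1/= !mul1r !retract_id// => h.
rewrite -(ler_pXn2r (n := 2))// ?nnegrE// real_normK ?num_real//.
apply: (le_trans h); rewrite expr2; apply: ler_pM; rewrite ?k0//; exact: kk.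
Qed.

End pd_kernel_global.

Section energy_kernel.
Context {R : realType} {d : nat}.
Local Notation E := (d.-tuple R).
Variables (X : set E) (beta B : R) (x0 : E).
Hypothesis beta02 : 0 < beta < 2.
Hypothesis XB : forall x y, X x -> X y -> dist2 x y <= B.
Hypothesis Xx0 : X x0.

Definition energy_kernel (x y : E) : R := - (dist2 x y `^ beta).

Lemma energy_kernel_sym x y : energy_kernel x y = energy_kernel y x.
Proof.
rewrite /energy_kernel !dist2_powR /sqdist.
by congr (- (_ `^ _)); apply: eq_bigr => i _; rewrite -sqrrN opprB.
Qed.

Lemma cpsd_energy_kernel : psd_mass [set 0]
  (fun x y => energy_kernel (retract X x0 x) (retract X x0 y)).
Proof.
apply: psd_mass_reindex; have -> : energy_kernel =
    (fun x y => - sqdist x y `^ (beta / 2)).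
  by apply/funext => x; apply/funext => y; rewrite /energy_kernel dist2_powR.
apply: cpsd_sqdist_powR; case/andP: beta02 => ? ?; apply/andP; split; lra.
Qed.

Lemma energy_kernel_bounds x y : X x -> X y ->
  - (B `^ beta) <= energy_kernel x y <= 0.
Proof.
move=> Xx Xy; rewrite /energy_kernel lerN2 oppr_le0 powR_ge0 andbT.
have d0 : 0 <= dist2 x y by exact: sqrtr_ge0.
apply: ge0_ler_powR; rewrite ?nnegrE//; first by case/andP: beta02 => /ltW.
  exact: le_trans d0 (XB Xx Xy).
exact: XB.
Qed.

Lemma measurable_energy_kernel :
  measurable_fun setT (fun z : E * E => energy_kernel z.1 z.2).
Proof.
rewrite /energy_kernel; under eq_fun do rewrite dist2_powR.
apply: measurableT_comp => //; apply: (measurableT_comp (measurable_powR _)).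
apply: measurable_sum => i; apply: measurable_funX; apply: measurable_funB.
  exact: (measurableT_comp (measurable_tnth i) measurable_fst).
exact: (measurableT_comp (measurable_tnth i) measurable_snd).
Qed.

Lemma energy_scoreE (Q : probability E R) y : measurable X -> Q X = 1%E ->
  X y -> energy_score X beta Q y = kernel_score X energy_kernel Q y.
Proof.
move=> mX QX Xy.
pose f1 (x z : E) := dist2 (retract X x0 x) (retract X x0 z) `^ beta.
have bE : bdmeas (fun z : E * E =>
    energy_kernel (retract X x0 z.1) (retract X x0 z.2)).
  apply: (@bdmeas_retract _ _ _ X x0 mX Xx0 _ (B `^ beta)).
    by apply: (measurable_funS measurableT) => //; exact: measurable_energy_kernel.
  move=> u v Xu Xv; case/andP: (energy_kernel_bounds Xu Xv) => h1 h2.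
  by rewrite ler0_norm// lerNl.
have bf : bdmeas (fun z : E * E => f1 z.1 z.2).
  have := bdmeasN bE; congr bdmeas; apply/funext => z.
  by rewrite /energy_kernel opprK.
have retr x : X x -> retract X x0 x = x by exact: retract_id.
rewrite /energy_score /kernel_score.
have -> : \int[Q]_(x in X) (dist2 x y `^ beta) = \int[Q]_x f1 x y.
  apply: Rintegral_full_measure => //; first exact: (bdmeas_section bf).
  by move=> x Xx; rewrite /f1 !retr.
have -> : \int[Q]_(x in X) energy_kernel x y = \int[Q]_x (- 1 * f1 x y).
  apply: Rintegral_full_measure => //; first exact/bdmeasZ/(bdmeas_section bf).
  by move=> x Xx; rewrite /f1 !retr// mulN1r.
have -> : \int[(Q \x Q)%E]_(z in X `*` X) (dist2 z.1 z.2 `^ beta) =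
    \int[(Q \x Q)%E]_z f1 z.1 z.2.
  apply: Rintegral_full_measure => //; first exact: measurableX.
    exact: full_measure_prod.
  by move=> z [Xz1 Xz2]; rewrite /f1 !retr.
have -> : \int[(Q \x Q)%E]_(z in X `*` X) energy_kernel z.1 z.2 =
    \int[(Q \x Q)%E]_z (- 1 * f1 z.1 z.2).
  apply: Rintegral_full_measure => //; first exact: measurableX.
  - exact: full_measure_prod.
  - exact: bdmeasZ.
  - by move=> z [Xz1 Xz2]; rewrite /f1 !retr// mulN1r.
rewrite !RintegralZ_bd//; last exact: (bdmeas_section bf).
by ring.
Qed.

End energy_kernel.

(** Division by zero gives 0, so for a degenerate kernel the stated bound is 2. This case is apart
    because [deviation_event_tail] needs positive [b] and [c]. *)
Lemma tail_bound_trivial {R : realType} (t : R) (m : \bar R) : (m <= 1)%E ->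
  (m <= (2 * expR (- (1 / 2 * (t / (8 * 0)) ^+ 2)))%:E)%E.
Proof.
move=> m1; apply: (le_trans m1).
by rewrite mulr0 invr0 mulr0 expr0n mulr0 oppr0 expR0 mulr1 lee_fin ler1n.
Qed.

Unset Implicit Arguments.
Set Strict Implicit.

Theorem theorem3 (R : realType) (d p : nat)
    (X : set (d.-tuple R)) (Theta : set (p.-tuple R))
    (P : p.-tuple R -> probability (d.-tuple R) R)
    (P0 : probability (d.-tuple R) R)
    (prior : p.-tuple R -> R) (w a1 a2 : R)
    (mX : measurable X) (mTheta : measurable Theta)
    (PX : statistical_model Theta P X) (P0X : P0 X = 1%E)
    (prior_dens : prob_density Theta prior)
    (w_gt0 : 0 < w) (a1_gt0 : 0 < a1) (a2_gt0 : 0 < a2) :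
  (forall (k : d.-tuple R -> d.-tuple R -> R) (kappa : R)
      (thetastar : p.-tuple R),
    pd_kernel X k ->
    (forall x, X x -> k x x <= kappa) ->
    is_argmin Theta P (divergence X (kernel_score X k)) P0 thetastar ->
    prior_mass_condition Theta P (divergence X (kernel_score X k)) P0
      thetastar prior a1 a2 ->
    forall (eps : R) (n : nat), 0 < eps -> (0 < n)%N ->
    (* below this threshold the displayed bound is not a tail bound *)
    a1 + a2 / w <= Num.sqrt n%:R * eps ->
    (tuple_measure P0 n
       (deviation_event Theta P X (kernel_score X k) w prior P0 thetastar eps)
     <= (2 * expR (- (1 / 2 * ((Num.sqrt n%:R * eps - a1 - a2 / w)
                               / (8 * kappa)) ^+ 2)))%:E)%E)
  /\
  (forall (beta B : R) (thetastar : p.-tuple R),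
    0 < beta < 2 ->
    (forall x y, X x -> X y -> dist2 x y <= B) ->
    is_argmin Theta P (divergence X (energy_score X beta)) P0 thetastar ->
    prior_mass_condition Theta P (divergence X (energy_score X beta)) P0
      thetastar prior a1 a2 ->
    forall (eps : R) (n : nat), 0 < eps -> (0 < n)%N ->
    a1 + a2 / w <= Num.sqrt n%:R * eps ->
    (tuple_measure P0 n
       (deviation_event Theta P X (energy_score X beta) w prior P0 thetastar
          eps)
     <= (2 * expR (- (1 / 2 * ((Num.sqrt n%:R * eps - a1 - a2 / w)
                               / (8 * B `^ beta)) ^+ 2)))%:E)%E).
Proof.
have [x0 Xx0] := full_measure_nonempty P0X.
split=> [k kappa thetastar kpd kk star mass eps n _ n0 hn|
         beta B thetastar beta02 XB star mass eps n _ n0 hn].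
- have [mk ks _] := kpd.
  have kM := pd_kernel_bounded kpd kk Xx0.
  have bk := bdmeas_retract mX Xx0 mk kM.
  have kp := psd_pd_kernel kpd Xx0.
  have kappa0 : 0 <= kappa by apply: le_trans (kM _ _ Xx0 Xx0).
  have SE (Q : probability (d.-tuple R) R) y : Q X = 1%E -> X y ->
    kernel_score X k Q y = kernel_score X k Q y by [].
  have [kappa_eq0|kappa_neq0] := eqVneq kappa 0.
    rewrite kappa_eq0; apply: tail_bound_trivial.
    exact: (deviation_event_le1 w mX mTheta PX P0X prior_dens Xx0 mk kM SE star).
  have kappa_gt0 : 0 < kappa by rewrite lt_def kappa_neq0.
  have sk : Num.sqrt kappa ^+ 2 = kappa by rewrite sqr_sqrtr.
  have sk0 : 0 < Num.sqrt kappa by rewrite sqrtr_gt0.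
  have -> : 8 * kappa = 4 * Num.sqrt kappa * (2 * Num.sqrt kappa).
    by rewrite -[in LHS]sk; ring.
  apply: (deviation_event_tail mX mTheta PX P0X prior_dens w_gt0 Xx0 mk ks kM
    SE star (g := fun _ => 0)) => //.
  + by rewrite mulr_gt0.
  + by move=> s _; exact: kp.
  + move=> x; rewrite exprMn sk -natrX.
    apply: (centered_diag_le P0 bk) => u v; first by apply: ks; exact: retract_mem.
    by apply: kM; exact: retract_mem.
  + move=> x s; apply: (embedding_deviation_pd P0 bk) => // u.
      by move=> v; apply: ks; exact: retract_mem.
    by apply: kk; exact: retract_mem.
- pose k := @energy_kernel R d beta.
  have mk : measurable_fun (X `*` X) (fun z => k z.1 z.2).
    by apply: (measurable_funS measurableT) => //; exact: measurable_energy_kernel.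
  have ks x y : X x -> X y -> k x y = k y x by move=> _ _; exact: energy_kernel_sym.
  have kB x y : X x -> X y -> - (B `^ beta) <= k x y <= 0.
    by move=> Xx Xy; exact: (energy_kernel_bounds beta02 XB).
  have kM x y : X x -> X y -> `|k x y| <= B `^ beta.
    move=> Xx Xy; case/andP: (kB _ _ Xx Xy) => h1 h2.
    by rewrite ler0_norm// lerNl.
  have bk := bdmeas_retract mX Xx0 mk kM.
  have kp := cpsd_energy_kernel X x0 beta02.
  have SE (Q : probability (d.-tuple R) R) y : Q X = 1%E -> X y ->
      energy_score X beta Q y = kernel_score X k Q y.
    exact: (energy_scoreE beta02 XB Xx0).
  have [Bb_eq0|Bb_neq0] := eqVneq (B `^ beta) 0.
    rewrite Bb_eq0; apply: tail_bound_trivial.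
    exact: (deviation_event_le1 w mX mTheta PX P0X prior_dens Xx0 mk kM SE star).
  have Bb_gt0 : 0 < B `^ beta by rewrite lt_def Bb_neq0 powR_ge0.
  pose c := Num.sqrt (2 * B `^ beta).
  have c2 : c ^+ 2 = 2 * B `^ beta by rewrite sqr_sqrtr// mulr_ge0// powR_ge0.
  have c0 : 0 < c by rewrite sqrtr_gt0 mulr_gt0.
  have -> : 8 * B `^ beta = 4 * c * c by rewrite -mulrA -expr2 c2; ring.
  have rs u v : k (retract X x0 u) (retract X x0 v) =
    k (retract X x0 v) (retract X x0 u) by exact: energy_kernel_sym.
  have kc x : centered P0 (global_kernel X x0 k) x x <= c ^+ 2.
    rewrite c2; apply: (centered_diag_le_npos P0 bk) => // u v.
    by apply: kB; exact: retract_mem.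
  (* The shift [g] is left open here; unification with [embedding_deviation_cpd] determines it. *)
  apply: (deviation_event_tail mX mTheta PX P0X prior_dens w_gt0 Xx0 mk ks kM
    SE star (b := c) (c := c)) => //.
  by move=> x s; apply: (embedding_deviation_cpd bk rs) => //; exact: ltW.
Qed.
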